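(* Let $X=\mathbb{R}\times G$, where $G$ is a finite Abelian group containing no elements of order $2$. Let $\alpha$ be a topological automorphism of $X$; it has the form $\alpha(t,g)=(at,\alpha_G g)$ for $t\in\mathbb{R}$, $g\in G$, where $a$ is a nonzero real number and $\alpha_G$ is an automorphism of $G$. Set $K=\mathrm{Ker}(I+\alpha_G)\subset G$. Let $\xi_1$ and $\xi_2$ be independent random variables with values in $X$ and distributions $\mu_1$ and $\mu_2$ whose characteristic functions do not vanish anywhere on the character group of $X$. Assume that the conditional distribution of the linear form $L_2=\xi_1+\alpha\xi_2$ given $L_1=\xi_1+\xi_2$ is symmetric. If $a\neq-1$, then $\mu_j=\gamma_j*\omega*E_{x_j}$, $j=1,2$, where $\gamma_j$ is a Gaussian distribution on $\mathbb{R}$ (regarded as the subgroup $\mathbb{R}\times\{0\}$ of $X$), $\omega$ is a distribution supported in $K$, and $x_j\in X$. If $a=-1$, then $\mu_j=\omega*E_{x_j}$, $j=1,2$, where $\omega$ is a distribution supported in $\mathbb{R}\times K$ and $x_j\in X$.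
   Context: For a locally compact Abelian group $X$ with character group $Y$, the characteristic function of a probability distribution $\mu$ on $X$ is $\hat\mu(y)=\int_X (x,y)\,d\mu(x)$, $y\in Y$, where $(x,y)$ is the value of the character $y$ at $x$. $E_x$ denotes the degenerate distribution at $x$, and $*$ denotes convolution. A Gaussian distribution on $\mathbb{R}$ is one with characteristic function $\exp\{-\sigma s^2+i\beta s\}$ with $\sigma\ge0$, $\beta\in\mathbb{R}$ (degenerate distributions included). ''The conditional distribution of $L_2$ given $L_1$ is symmetric'' means that the random vectors $(L_1,L_2)$ and $(L_1,-L_2)$ have the same distribution. *)

(* Defs.v *)
From HB Require Import structures.
From mathcomp Require Import all_boot all_order all_algebra.
From mathcomp Require Import all_classical all_reals all_analysis.
Set Implicit Arguments. Unset Strict Implicit. Unset Printing Implicit Defensive.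
Import Order.TTheory GRing.Theory Num.Theory.
Local Open Scope classical_set_scope.
Local Open Scope ring_scope.

Definition discr (G : finZmodType) : Type := G.
HB.instance Definition _ (G : finZmodType) := GRing.Zmodule.on (discr G).
HB.instance Definition _ (G : finZmodType) := Choice.on (discr G).
HB.instance Definition _ (G : finZmodType) := isPointed.Build (discr G) 0.
HB.instance Definition _ (G : finZmodType) :=
  @isMeasurable.Build default_measure_display (discr G) discrete_measurable
    discrete_measurable0 discrete_measurableC discrete_measurableU.

Definition XT (R : realType) (G : finZmodType) := (R * discr G)%type.

Definition addX (R : realType) (G : finZmodType) (x y : XT R G) : XT R G :=
  (x.1 + y.1, x.2 + y.2).
Definition oppX (R : realType) (G : finZmodType) (x : XT R G) : XT R G :=
  (- x.1, - x.2).

(* Characters of a finite abelian group G, written via their argument: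
   chi(g) = exp(i theta(g)) with theta a homomorphism G -> R/2piZ. *)
Definition is_character_arg (R : realType) (G : finZmodType) (theta : G -> R) :=
  forall g h : G, exists k : int, theta (g + h) = theta g + theta h + k%:~R * (2 * pi).

Definition charfun_re (R : realType) (G : finZmodType)
  (mu : set (XT R G) -> \bar R) (s : R) (theta : G -> R) : \bar R :=
  (\int[mu]_x (cos (s * x.1 + theta x.2))%:E)%E.
Definition charfun_im (R : realType) (G : finZmodType)
  (mu : set (XT R G) -> \bar R) (s : R) (theta : G -> R) : \bar R :=
  (\int[mu]_x (sin (s * x.1 + theta x.2))%:E)%E.

(* Gaussian distribution on R: characteristic function exp(-sigma s^2 + i beta s),
   sigma >= 0 (degenerate distributions included). *)
Definition gaussian (R : realType) (gam : set R -> \bar R) :=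
  exists sigma beta : R, 0 <= sigma /\
    forall s : R,
      (\int[gam]_t (cos (s * t))%:E)%E = (expR (- sigma * s ^+ 2) * cos (beta * s))%:E /\
      (\int[gam]_t (sin (s * t))%:E)%E = (expR (- sigma * s ^+ 2) * sin (beta * s))%:E.

Definition embR (R : realType) (G : finZmodType) (gam : set R -> \bar R)
  : set (XT R G) -> \bar R :=
  fun A => gam [set t | A (t, 0)].

Definition convX (R : realType) (G : finZmodType) (mu nu : set (XT R G) -> \bar R)
  : set (XT R G) -> \bar R :=
  fun A => (\int[mu]_x nu [set y | A (addX x y)])%E.

(* Main.v *)
(* Let f_j be the characteristic function of xi_j and B the dual of alpha. The
   hypotheses say that f_1(u+v) f_2(u+Bv) = f_1(u-v) f_2(u-Bv) for all characters
   u, v of R x G.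

   Eliminating factors by shifts shows that all triple multiplicative differences
   of f_j along suitable subgroups are 1. On the characters of G, periodicity
   turns this into multiplicativity of |f_j|, and together with |f_j| <= 1 it
   gives |f_j| = 1 on the characters m + m o alpha_G (up to an injective factor),
   i.e. the G-component of xi_j lies a.s. in one coset of K. On that coset alpha_G
   acts as -1 up to a translation, so L_1 + L_2 and L_1 - L_2 determine the
   (G-components of the) two variables, and symmetry exchanges their laws up to
   a shift: for a = -1 this is already the theorem.

   For a <> -1, the equation at u = (s, m), v = (t, m) has separated variables
   and gives f_j(s, 2m) = f_j(s, 0) f_j(0, 2m), i.e. the two components of xi_j
   are independent. On R, the triple difference identity yields
   F(x+y) F(x-y) = F(x)^2 |F(y)|^2 for F = f_1(., 0), whose continuous solutions
   are exp(-sigma s^2 + i b s); the law of the real component of xi_j is the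
   Gaussian factor, no Gaussian measure has to be constructed. *)

(* The two factors of X resist for opposite reasons. On the characters of G no analysis is
   available, and the cube identity helps only because squared moduli are positive and periodic
   there: a positive geometric progression with a period is constant. This says nothing about
   phases, so the G-components are compared through the laws themselves, as images of (L_1, L_2) and
   (L_1, - L_2) under one map. On R continuity replaces periodicity. The increments of the cube are
   (1 + a), 2 and (1 - a) times free parameters, so a = -1 is excluded and a = 1 is treated apart,
   where all moduli turn out to be 1.

   A uniqueness property of characteristic functions is needed only to turn their factorization into
   independence of the two components. It is obtained from trigonometric polynomials, which tend
   boundedly to the indicator of a half-line on R and interpolate every function on G.

   Characters of G are given by real arguments that are additive only modulo 2 pi. The functional
   equations therefore concern functionals of arguments, and arguments are compared after applying
   [cis]. The absence of elements of order 2 makes doubling a bijection of G, which permits every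
   halving below. *)
Require Import Defs.
From HB Require Import structures.
From mathcomp Require Import all_boot all_order all_algebra.
From mathcomp Require Import all_fingroup all_solvable all_field all_character.
From mathcomp Require Import all_classical all_reals all_analysis.
From mathcomp Require Import measurable_realfun complex ring lra.
Set Implicit Arguments. Unset Strict Implicit. Unset Printing Implicit Defensive.
Import Order.TTheory GRing.Theory Num.Theory numFieldNormedType.Exports.
Local Open Scope classical_set_scope.
Local Open Scope ring_scope.
Local Open Scope complex_scope.

(** * Characters of a finite abelian group *)

Definition cis (R : realType) (x : R) : R[i] := cos x +i* sin x.

Lemma cisD (R : realType) (x y : R) : cis (x + y) = cis x * cis y.
Proof. by apply/eqP; rewrite eq_complex /= sinD cosD; apply/andP; split; apply/eqP; ring. Qed.

Lemma cis0 (R : realType) : cis (0 : R) = 1.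
Proof. by rewrite /cis cos0 sin0. Qed.

Lemma cisN (R : realType) (x : R) : cis (- x) = conjc (cis x).
Proof. by rewrite /cis cosN sinN. Qed.

Lemma cis_conj (R : realType) (x : R) : cis x * conjc (cis x) = 1.
Proof. by rewrite -cisN -cisD subrr cis0. Qed.

Lemma cis_neq0 (R : realType) (x : R) : cis x != 0.
Proof.
apply/eqP => h; have := cis_conj x; rewrite h mul0r => /esym/eqP.
by rewrite oner_eq0.
Qed.

Lemma cisMn (R : realType) (x : R) n : cis (x *+ n) = cis x ^+ n.
Proof. by elim: n => [|n IH]; rewrite ?mulr0n ?cis0 ?expr0 // mulrS exprS cisD IH. Qed.

Lemma cis2pi (R : realType) (k : int) : cis (k%:~R * (2 * pi : R)) = 1.
Proof.
have h : cis (2 * pi : R) = 1.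
  by rewrite /cis mulr_natl cos2pi mulr2n sinDpi sinpi oppr0.
rewrite mulrC; case: k => n.
  by rewrite pmulrn mulr_natr cisMn h expr1n.
by rewrite NegzE mulrNz mulrN pmulrn mulr_natr cisN cisMn h expr1n conjc1.
Qed.

Lemma cis_eq1 (R : realType) (x : R) : 0 <= x < 2 * pi -> cis x = 1 -> x = 0.
Proof.
move=> /andP[x0 x2] /eqP; rewrite eq_complex /= => /andP[/eqP c1 _].
have [//|xn0] := eqVneq x 0.
have hx : 0 < sin (x / 2).
  apply: sin_gt0_pi; apply/andP; split; last by lra.
  by rewrite divr_gt0 // lt0r xn0.
have := cos_mulr2n (x / 2).
rewrite (_ : x / 2 *+ 2 = x); last by field.
rewrite c1 cos2sin2 => h.
have : 0 < sin (x / 2) ^+ 2 by rewrite exprn_gt0.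
lra.
Qed.

Lemma character_cisD (R : realType) (G : finZmodType) (theta : G -> R) :
  is_character_arg theta ->
  forall g h, cis (theta (g + h)) = cis (theta g) * cis (theta h).
Proof. by move=> th g h; have [k ->] := th g h; rewrite !cisD cis2pi mulr1. Qed.

Lemma character_cis0 (R : realType) (G : finZmodType) (theta : G -> R) :
  is_character_arg theta -> cis (theta 0) = 1.
Proof.
move=> th; have := character_cisD th 0 0; rewrite addr0.
by move=> /(canLR (mulfK (cis_neq0 _))); rewrite divff ?cis_neq0.
Qed.

(** The irreducible complex characters of an abelian group are linear and their kernels intersect
    trivially. Their values are algebraic numbers, not elements of [R[i]], so the character is
    transported through discrete logarithms: a value z^k, with z a primitive n-th root of unity,
    becomes the real argument 2 pi k / n. *)
Lemma character_separation (R : realType) (G : finZmodType) (g : G) :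
  g != 0 -> exists2 theta : G -> R, is_character_arg theta & cis (theta g) != 1.
Proof.
move=> g0.
have ab : abelian [set: G]%G by apply/centsP => x _ y _; exact: addrC.
have [i gi] : exists i : Iirr [set: G]%G, g \notin cfker 'chi_i.
  apply/existsP; rewrite -[[exists _, _]]negbK negb_exists; apply/negP => /forallP h.
  have : g \in (\bigcap_(i < Nirr [set: G]%G) cfker 'chi_i)%SET.
    by apply/bigcapP => i _; have := h i; rewrite negbK.
  by rewrite TI_cfker_irr inE => /eqP e; move: g0; rewrite e eqxx.
have lin := char_abelianP _ ab i.
pose n := #|[set: G]%G|.
have n0 : (0 < n)%N by exact: cardG_gt0.
have [z zP] := C_prim_root_exists n0.
have ex x : {k : 'I_n | 'chi_i x = z ^+ k}.
  apply: (prim_rootP zP); rewrite -lin_charX ?inE //.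
  by rewrite expg_cardG ?inE // lin_char1.
pose k x : nat := sval (ex x).
have kE x : 'chi_i x = z ^+ k x by rewrite /k; case: (ex x).
have kn x : (k x < n)%N by rewrite /k; case: (ex x).
have kD (x y : G) : k (x + y)%R = (k x + k y)%N %[mod n].
  apply/eqP; rewrite -(eq_prim_root_expr zP) exprD -!kE.
  by apply/eqP; apply: (lin_charM lin); rewrite inE.
have nR : (n%:R : R) != 0 by rewrite pnatr_eq0 -lt0n.
exists (fun x => (k x)%:R / n%:R * (2 * pi)).
  move=> x y.
  have E := divn_eq (k x + k y) n; rewrite -kD modn_small // in E.
  (* Discrete logarithms lie below n, so they add up to a carry, here the quotient by n. *)
  exists (- ((k x + k y) %/ n)%:Z).
  rewrite mulrNz -pmulrn.
  have : ((k x)%:R + (k y)%:R : R) =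
    ((k x + k y) %/ n)%:R * n%:R + (k (x + y))%:R by rewrite -!natrD {1}E natrD natrM.
  move=> h; apply: (mulfI nR); move: h.
  set a := ((k x + k y) %/ n)%:R; set b := (k (x + y))%:R.
  set c := (k x)%:R; set d := (k y)%:R => h.
  have -> : b = c + d - a * n%:R by rewrite h; ring.
  by field.
apply/eqP => /cis_eq1 h.
have pi0 := pi_gt0 R.
have kg : k g = 0%N.
  have /h : 0 <= (k g)%:R / n%:R * (2 * pi : R) < 2 * pi.
    rewrite mulr_ge0 ?divr_ge0 ?mulr_ge0 ?(ltW pi0) //=.
    by rewrite gtr_pMl ?mulr_gt0 // ltr_pdivrMr ?ltr0n // mul1r ltr_nat.
  move=> /eqP; rewrite !mulf_eq0 invr_eq0 (negbTE nR) pnatr_eq0.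
  by rewrite (gt_eqF pi0) (pnatr_eq0 _ 2) !orbF => /eqP.
by move: gi; rewrite cfkerEirr inE kE kg lin_char1 // expr0 eqxx.
Qed.

Lemma character_cis_order (R : realType) (G : finZmodType) (theta : G -> R) :
  is_character_arg theta -> forall g, cis (theta g *+ #|G|) = 1.
Proof.
move=> h g; rewrite cisMn.
have E n : cis (theta (g *+ n)) = cis (theta g) ^+ n.
  elim: n => [|n IH]; first by rewrite mulr0n expr0 character_cis0.
  by rewrite mulrS exprS character_cisD // IH.
rewrite -E (_ : g *+ #|G| = 0) ?character_cis0 //.
have gG : g \in [set: G]%G by rewrite inE.
by have := expg_cardG gG; rewrite cardsT.
Qed.

(** * The Heyde functional equation *)

Section HeydeEquation.
Variables (T : Type) (R : comRingType) (K : fieldType) (al : T -> T).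
Variables (S : (T -> R) -> Prop) (f1 f2 : (T -> R) -> K).

(** The third multiplicative difference of [f] at [x] with increments [k], [l], [m] equals 1,
    written without inverses: odd vertices of the cube on the left, even vertices on the right. *)
Definition cube_identity (f : (T -> R) -> K) (x k l m : T -> R) :=
  f (fun t => x t + k t + l t + m t) * f (fun t => x t + k t) *
    f (fun t => x t + l t) * f (fun t => x t + m t) =
  f x * f (fun t => x t + k t + l t) * f (fun t => x t + k t + m t) *
    f (fun t => x t + l t + m t).

Hypothesis SD : forall u v, S u -> S v -> S (fun t => u t + v t).
Hypothesis SN : forall u, S u -> S (fun t => - u t).
Hypothesis Sal : forall u, S u -> S (fun t => u (al t)).
Hypothesis heyde : forall u v, S u -> S v ->
  f1 (fun t => u t + v t) * f2 (fun t => u t + v (al t)) =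
  f1 (fun t => u t - v t) * f2 (fun t => u t - v (al t)).
Hypothesis f1_neq0 : forall u, S u -> f1 u != 0.
Hypothesis f2_neq0 : forall u, S u -> f2 u != 0.

Let heydeE u v w1 w2 w3 w4 : S u -> S v ->
  (forall t, w1 t = u t + v t) -> (forall t, w2 t = u t + v (al t)) ->
  (forall t, w3 t = u t - v t) -> (forall t, w4 t = u t - v (al t)) ->
  f1 w1 * f2 w2 = f1 w3 * f2 w4.
Proof.
by move=> Su Sv /funext -> /funext -> /funext -> /funext ->; exact: heyde.
Qed.

(** The indices are those of the shifts (k, l, m). Each b ignores m, each c ignores l and each d
    ignores k, so each of them occurs once at an odd and once at an even vertex and drops out of the
    alternating product. Only the b have to be cancelled as factors. *)
Let cancel8 (a000 a001 a010 a011 a100 a101 a110 a111 : K)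
    (b00 b01 b10 b11 c00 c01 c10 c11 d00 d01 d10 d11 : K) :
  b00 != 0 -> b01 != 0 -> b10 != 0 -> b11 != 0 ->
  a000 * b00 = c00 * d00 -> a001 * b00 = c01 * d01 ->
  a010 * b01 = c00 * d10 -> a011 * b01 = c01 * d11 ->
  a100 * b10 = c10 * d00 -> a101 * b10 = c11 * d01 ->
  a110 * b11 = c10 * d10 -> a111 * b11 = c11 * d11 ->
  a111 * a100 * a010 * a001 = a000 * a110 * a101 * a011.
Proof.
move=> h0 h1 h2 h3 e000 e001 e010 e011 e100 e101 e110 e111.
have h : b00 * b01 * b10 * b11 != 0 by rewrite !mulf_neq0.
apply: (mulIf h).
have -> : a111 * a100 * a010 * a001 * (b00 * b01 * b10 * b11) =
  (a111 * b11) * (a100 * b10) * (a010 * b01) * (a001 * b00) by ring.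
have -> : a000 * a110 * a101 * a011 * (b00 * b01 * b10 * b11) =
  (a000 * b00) * (a110 * b11) * (a101 * b10) * (a011 * b01) by ring.
by rewrite e000 e001 e010 e011 e100 e101 e110 e111; ring.
Qed.

Ltac inS := repeat first [assumption | apply: SD | apply: SN |
  match goal with |- S (fun t => ?u (al t)) => apply: (Sal (u := u)) end].

Ltac heydeI z U V u v := apply: (@heydeE u v); [inS | inS | move=> t; rewrite /z /U /V /=; ring ..].

(* The shifts [(u, v) += (k o al, k)], [(l, l)] and [(- m o al, m)] leave the
   arguments of the second, third and fourth factors of the equation fixed. *)
Lemma heyde_cube1 x k l m : S x -> S k -> S l -> S m ->
  cube_identity f1 x (fun t => k t + k (al t)) (fun t => l t + l t)
    (fun t => m t - m (al t)).
Proof.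
move=> Sx Sk Sl Sm; rewrite /cube_identity.
pose z (t : T) : R := 0.
have Sz : S z by rewrite (_ : z = fun t => x t - x t); [inS | apply: funext => t; rewrite /z subrr].
pose U (k l m : T -> R) t := x t + k (al t) + l t - m (al t).
pose V (k l m : T -> R) t := k t + l t + m t.
(* With (u, v) = ([U], [V]), these are the second, third and fourth factors of the equation, each
   free of one shift. *)
pose b (k l : T -> R) := f2 (fun t => x t + k (al t) + k (al t) + l t + l (al t)).
pose c (k m : T -> R) := f1 (fun t => x t + k (al t) - k t - m t - m (al t)).
pose d (l m : T -> R) := f2 (fun t => x t + l t - l (al t) - m (al t) - m (al t)).
apply: (@cancel8 _ _ _ _ _ _ _ _ (b z z) (b z l) (b k z) (b k l)
  (c z z) (c z m) (c k z) (c k m) (d z z) (d z m) (d l z) (d l m)).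
1-4: by apply: f2_neq0; inS.
- heydeI z U V (U z z z) (V z z z).
- heydeI z U V (U z z m) (V z z m).
- heydeI z U V (U z l z) (V z l z).
- heydeI z U V (U z l m) (V z l m).
- heydeI z U V (U k z z) (V k z z).
- heydeI z U V (U k z m) (V k z m).
- heydeI z U V (U k l z) (V k l z).
- heydeI z U V (U k l m) (V k l m).
Qed.

(** Now the second factor is isolated: the shifts (k, k), (l o al, l) and (- m, m) of (u, v) fix the
    third, fourth and first factor respectively. *)
Lemma heyde_cube2 x k l m : S x -> S k -> S l -> S m ->
  cube_identity f2 x (fun t => k t + k (al t)) (fun t => l (al t) + l (al t))
    (fun t => m (al t) - m t).
Proof.
move=> Sx Sk Sl Sm; rewrite /cube_identity.
pose z (t : T) : R := 0.
have Sz : S z by rewrite (_ : z = fun t => x t - x t); [inS | apply: funext => t; rewrite /z subrr].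
pose U (k l m : T -> R) t := x t + k t + l (al t) - m t.
pose V (k l m : T -> R) t := k t + l t + m t.
pose b (k l : T -> R) := f1 (fun t => x t + k t + k t + l t + l (al t)).
pose c (k m : T -> R) := f2 (fun t => x t + k t - k (al t) - m t - m (al t)).
pose d (l m : T -> R) := f1 (fun t => x t - l t + l (al t) - m t - m t).
apply: (@cancel8 _ _ _ _ _ _ _ _ (b z z) (b z l) (b k z) (b k l)
  (c z z) (c z m) (c k z) (c k m) (d z z) (d z m) (d l z) (d l m)).
1-4: by apply: f1_neq0; inS.
all: rewrite [LHS]mulrC [RHS]mulrC.
- heydeI z U V (U z z z) (V z z z).
- heydeI z U V (U z z m) (V z z m).
- heydeI z U V (U z l z) (V z l z).
- heydeI z U V (U z l m) (V z l m).
- heydeI z U V (U k z z) (V k z z).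
- heydeI z U V (U k z m) (V k z m).
- heydeI z U V (U k l z) (V k l z).
- heydeI z U V (U k l m) (V k l m).
Qed.

End HeydeEquation.

(** * Periodic squared moduli *)

Section PeriodicModulus.
Variables (T : Type) (R : comRingType) (K : realFieldType).

(** The ratio is a positive root of unity in an ordered field, hence 1. This is why the argument is
    run on squared moduli. *)
Lemma geometric_periodic (rho : nat -> K) n :
  (forall i, 0 < rho i) -> (forall i, rho i.+2 * rho i = rho i.+1 ^+ 2) ->
  rho n.+1 = rho 0%N -> rho 1%N = rho 0%N.
Proof.
move=> rho0 geo per; pose c := rho 1%N / rho 0%N.
have rn i : rho i != 0 by rewrite gt_eqF.
have step i : rho i.+1 = rho i * c.
  elim: i => [|i IH]; first by rewrite /c mulrC divfK.
  apply: (mulIf (rn i)); rewrite geo expr2 {2}IH; ring.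
have powc i : rho i = rho 0%N * c ^+ i.
  by elim: i => [|i IH]; rewrite ?expr0 ?mulr1 // step IH exprSr mulrA.
have : c ^+ n.+1 = 1.
  by apply: (mulfI (rn 0%N)); rewrite -powc per mulr1.
move/eqP; rewrite pexpr_eq1 ?divr_ge0 ?ltW // => /eqP c1.
by rewrite powc c1 expr1n mulr1.
Qed.

(* A cube identity with two equal increments says that [i -> f (i m + k) / f (i m)]
   is a geometric progression; periodicity makes it constant. *)
Lemma cube_periodic (f : (T -> R) -> K) (S : (T -> R) -> Prop) (k m : T -> R) n :
  (forall u v, S u -> S v -> S (fun t => u t + v t)) -> S k -> S m ->
  S (fun=> 0) ->
  (forall u, S u -> 0 < f u) ->
  (forall u, S u -> f (fun t => u t + m t *+ n.+1) = f u) ->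
  (forall x, S x -> cube_identity f x k m m) ->
  f (fun=> 0) = 1 ->
  f (fun t => m t + k t) = f m * f k.
Proof.
move=> SD Sk Sm S0 fpos per cube f0.
pose p i := fun t => m t *+ i.
have Sp i : S (p i).
  elim: i => [|i IH].
    by rewrite (_ : p 0%N = fun=> 0) //; apply: funext => t; rewrite /p mulr0n.
  rewrite (_ : p i.+1 = fun t => p i t + m t); first exact: SD.
  by apply: funext => t; rewrite /p mulrSr.
have fn u : S u -> f u != 0 by move=> /fpos; rewrite lt0r => /andP[].
pose pk i t := p i t + k t.
have Spk i : S (pk i) by apply: SD.
have /= : f (pk 1%N) / f (p 1%N) = f (pk 0%N) / f (p 0%N).
  apply: (@geometric_periodic (fun i => f (pk i) / f (p i)) n).
  - by move=> i; rewrite divr_gt0 ?fpos.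
  - move=> i; have := cube (p i) (Sp i); rewrite /cube_identity.
    have -> : (fun t => p i t + k t + m t + m t) = pk i.+2.
      by apply: funext => t; rewrite /pk /p !mulrSr; ring.
    have -> : (fun t => p i t + k t) = pk i by [].
    have -> : (fun t => p i t + m t) = p i.+1.
      by apply: funext => t; rewrite /p mulrSr.
    have -> : (fun t => p i t + k t + m t) = pk i.+1.
      by apply: funext => t; rewrite /pk /p !mulrSr; ring.
    have -> : (fun t => p i t + m t + m t) = p i.+2.
      by apply: funext => t; rewrite /p !mulrSr.
    have h1 := fn _ (Sp i); have h2 := fn _ (Sp i.+1); have h3 := fn _ (Sp i.+2).
    move=> E.
    apply: (mulIf (mulf_neq0 (mulf_neq0 h1 h3) (mulf_neq0 h2 h2))).
    have -> : f (pk i.+2) / f (p i.+2) * (f (pk i) / f (p i)) *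
      (f (p i) * f (p i.+2) * (f (p i.+1) * f (p i.+1))) =
      f (pk i.+2) * f (pk i) * f (p i.+1) * f (p i.+1) by field; rewrite h1 h3.
    by rewrite E; field.
  - rewrite /=.
    have -> : pk n.+1 = fun t => pk 0%N t + m t *+ n.+1.
      by apply: funext => t; rewrite /pk /p mulr0n add0r addrC.
    have -> : p n.+1 = fun t => p 0%N t + m t *+ n.+1.
      by apply: funext => t; rewrite /p mulr0n add0r.
    by rewrite !per.
have -> : p 0%N = fun=> 0 by apply: funext => t; rewrite /p mulr0n.
have -> : p 1%N = m by apply: funext => t; rewrite /p mulr1n.
have -> : pk 0%N = k by apply: funext => t; rewrite /pk /p mulr0n add0r.
have -> : pk 1%N = fun t => m t + k t by apply: funext => t; rewrite /pk /p mulr1n.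
rewrite f0 divr1 => <-; rewrite mulrC divfK //; exact: fn.
Qed.

Variables (al : T -> T) (S : (T -> R) -> Prop) (f1 f2 : (T -> R) -> K).
Hypothesis SD : forall u v, S u -> S v -> S (fun t => u t + v t).
Hypothesis SN : forall u, S u -> S (fun t => - u t).
Hypothesis Sal : forall u, S u -> S (fun t => u (al t)).
Hypothesis heyde : forall u v, S u -> S v ->
  f1 (fun t => u t + v t) * f2 (fun t => u t + v (al t)) =
  f1 (fun t => u t - v t) * f2 (fun t => u t - v (al t)).
Hypothesis f1_gt0 : forall u, S u -> 0 < f1 u.
Hypothesis f2_gt0 : forall u, S u -> 0 < f2 u.
Hypothesis f1_le1 : forall u, S u -> f1 u <= 1.
Hypothesis f2_le1 : forall u, S u -> f2 u <= 1.
Hypothesis f1_even : forall u, S u -> f1 (fun t => - u t) = f1 u.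
Hypothesis f2_even : forall u, S u -> f2 (fun t => - u t) = f2 u.
Hypothesis f1_0 : f1 (fun=> 0) = 1.
Hypothesis f2_0 : f2 (fun=> 0) = 1.
Variable n : nat.
Hypothesis f1_per : forall u v, S u -> S v -> f1 (fun t => u t + v t *+ n.+1) = f1 u.
Hypothesis f2_per : forall u v, S u -> S v -> f2 (fun t => u t + v t *+ n.+1) = f2 u.

Let Sal2 u : S u -> S (fun t => u (al (al t))).
Proof. by move=> Su; exact: (Sal (Sal Su)). Qed.

Ltac inS := repeat first [assumption | apply: SD | apply: SN |
  match goal with |- S (fun t => ?u (al t)) => apply: (Sal (u := u)) end |
  match goal with |- S (fun t => ?u (al (al t))) =>
    apply: (Sal2 (u := u)) end].

(** The cube increments can be made (w, M, M) for [f1] and (w, M', M') for [f2], so [cube_periodic]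
    splits f1 (M + w) and f2 (M' + w). Two instances of the equation then give f1 M f1 w f2 w = f2 M
    and f2 M f2 w f1 w = f1 M. Hence (f1 w f2 w)^2 = 1, and both factors are at most 1. *)
Lemma heyde_modulus_eq1 th : S th ->
  let w := fun t => (th (al t) + th (al (al t))) *+ 2 in
  f1 w = 1 /\ f2 w = 1.
Proof.
move=> Sth w.
(* The factor 2 lets [M] be of the form l + l as well as m - m o al. The composition with [al] does
   the same for [M'], which must be of the form 2 (l o al) in [heyde_cube2]. *)
pose phi t := th (al t) + th (al t).
have Sphi : S phi by rewrite /phi; inS.
pose M t := phi t - phi (al t).
pose M' t := phi (al t) - phi t.
have SM : S M.
rewrite /M. inS.
have SM' : S M' by rewrite /M'; inS.
have S0 : S (fun=> 0).
  rewrite (_ : (fun=> 0) = fun t => th t - th t); first by inS.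
  by apply: funext => t; rewrite subrr.
have Sw : S w.
  by rewrite /w; under eq_fun do rewrite mulr2n; inS.
have f1n u : S u -> f1 u != 0 by move=> /f1_gt0; rewrite lt0r => /andP[].
have f2n u : S u -> f2 u != 0 by move=> /f2_gt0; rewrite lt0r => /andP[].
have e1 : f1 (fun t => M t + w t) = f1 M * f1 w.
  apply: (@cube_periodic _ S _ _ n) => //; first by move=> u Su; exact: f1_per.
  move=> x Sx.
  have := @heyde_cube1 T R K al S f1 f2 SD SN Sal heyde f2n x phi
    (fun t => th (al t) - th (al (al t))) phi Sx Sphi _ Sphi.
  rewrite /phi (_ : (fun t => _ - _ + _) = M); last by apply: funext => t; rewrite /M /phi; ring.
  rewrite (_ : (fun t => _ + _ + _) = w); last by apply: funext => t; rewrite /w; ring.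
  by apply; inS.
have e2 : f2 (fun t => M' t + w t) = f2 M' * f2 w.
  apply: (@cube_periodic _ S _ _ n) => //; first by move=> u Su; exact: f2_per.
  move=> x Sx.
  have := @heyde_cube2 T R K al S f1 f2 SD SN Sal heyde f1n x phi
    (fun t => th (al t) - th t) phi Sx Sphi _ Sphi.
  rewrite /phi (_ : (fun t => _ - _ + _) = M'); last by apply: funext => t; rewrite /M' /phi; ring.
  rewrite (_ : (fun t => _ + _ + _) = w); last by apply: funext => t; rewrite /w; ring.
  by apply; inS.
(* In each instance one argument on the right vanishes, the left arguments are [w] and twice [phi]
   or twice phi o al, and these doubles are M + w and M' + w. *)
have a1 := heyde Sphi Sphi; have a2 := heyde (Sal Sphi) Sphi.
have M1 : f1 M' = f1 M.
  by rewrite -(f1_even SM'); congr f1; apply: funext => t; rewrite /M /M' opprB.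
have M2 : f2 M' = f2 M.
  by rewrite -(f2_even SM'); congr f2; apply: funext => t; rewrite /M /M' opprB.
have E1 : f1 M * f1 w * f2 w = f2 M.
  rewrite -e1; move: a1.
  rewrite (_ : (fun t => phi t + phi t) = fun t => M t + w t); last first.
    by apply: funext => t; rewrite /M /w /phi; ring.
  rewrite (_ : (fun t => phi t + phi (al t)) = w); last first.
    by apply: funext => t; rewrite /w /phi; ring.
  move=> ->; rewrite (_ : (fun t => phi t - phi t) = fun=> 0) ?f1_0 ?mul1r //.
  by apply: funext => t; rewrite subrr.
have E2 : f2 M * f2 w * f1 w = f1 M.
  rewrite -M2 -e2; move: a2.
  rewrite (_ : (fun t => phi (al t) + phi (al t)) = fun t => M' t + w t); last first.
    by apply: funext => t; rewrite /M' /w /phi; ring.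
  rewrite (_ : (fun t => phi (al t) + phi t) = w); last first.
    by apply: funext => t; rewrite /w /phi; ring.
  rewrite mulrC => ->.
  rewrite (_ : (fun t => phi (al t) - phi (al t)) = fun=> 0) ?f2_0 ?mulr1 //.
  by apply: funext => t; rewrite subrr.
have [h1 h2] := (f1_gt0 Sw, f2_gt0 Sw); have [h3 h4] := (f1_le1 Sw, f2_le1 Sw).
have sq : (f1 w * f2 w) ^+ 2 = 1.
  apply: (mulfI (f1n _ SM)); rewrite mulr1 -[RHS]E2 -E1; ring.
have p1 : f1 w * f2 w = 1.
  by apply/eqP; rewrite -(@pexpr_eq1 _ _ 2) ?mulr_ge0 ?(ltW h1) ?(ltW h2) // sq.
split; apply/eqP; rewrite eq_le ?h3 ?h4 /=.
- by rewrite -p1 ler_piMr // ltW.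
- by rewrite -p1 ler_piMl // ltW.
Qed.

End PeriodicModulus.

(** * Continuous solutions on the real line *)

(** Dyadic multiples of [d] are dense. The unit [d] is left free because
    [continuous_circle_morphism] must start close to 0. *)
Lemma continuous_dyadic_eq0 (R : realType) (f : R -> R) (d : R) :
  0 < d -> continuous f ->
  (forall (m : int) n, f (m%:~R * (d / 2 ^+ n)) = 0) -> forall x, f x = 0.
Proof.
move=> d0 cf f0 x.
have p2 n : (0 : R) < 2 ^+ n by rewrite exprn_gt0.
pose s n := (Num.floor (x / (d / 2 ^+ n)))%:~R * (d / 2 ^+ n).
have dn n : 0 < d / 2 ^+ n by rewrite divr_gt0.
have bound n : `|x - s n| <= d / 2 ^+ n.
  have /andP[h1 h2] := floor_itv (x / (d / 2 ^+ n)).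
  rewrite -{1}(divfK (lt0r_neq0 (dn n)) x) /s -mulrBl normrM.
  rewrite (gtr0_norm (dn n)); apply: ler_piMl; first exact: ltW.
  rewrite ler_norml.
  by move: h1 h2; rewrite intrD => h1 h2; apply/andP; split; lra.
have lim0 : d / 2 ^+ n @[n --> \oo] --> (0 : R).
  under eq_fun do rewrite -exprVn.
  rewrite -(mulr0 d); apply: cvgMl_tmp; apply: cvg_expr.
  by rewrite ger0_norm ?invr_ge0 // invf_lt1 // ltr1n.
have sx : s @ \oo --> x.
  apply/cvgrPdist_le => e e0; near=> n.
  apply: le_trans (bound n) _.
  near: n; have /cvgrPdist_le := lim0 => /(_ e e0).
  by apply: filterS => n; rewrite sub0r normrN gtr0_norm.
have fs : (f \o s) @ \oo --> f x by exact: (continuous_cvg _ (cf x) sx).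
have : (f \o s) @ \oo --> (0 : R).
  have -> : f \o s = cst 0 by apply: funext => n; exact: f0.
  exact: cvg_cst.
by move=> h; exact: (cvg_unique _ fs h).
Unshelve. all: by end_near. Qed.

Lemma continuous_parallelogram (R : realType) (q : R -> R) : continuous q ->
  (forall x y, q (x + y) + q (x - y) = q x *+ 2 + q y *+ 2) ->
  forall x, q x = q 1 * x ^+ 2.
Proof.
move=> cq par x.
have q0 : q 0 = 0 by have := par 0 0; rewrite addr0 subr0 !mulr2n; lra.
have qN y : q (- y) = q y by have := par 0 y; rewrite add0r sub0r q0 !mulr2n; lra.
(* The parallelogram law is a second-order recurrence along multiples of y, so two consecutive
   values are carried. *)
have qn n y : q (y *+ n) = q y *+ (n ^ 2) /\ q (y *+ n.+1) = q y *+ (n.+1 ^ 2).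
  elim: n => [|n [IH1 IH2]]; first by rewrite mulr0n mulr1n mulr1n q0 mulr0n.
  split=> //; have := par (y *+ n.+1) y.
  rewrite -mulrSr (_ : y *+ n.+1 - y = y *+ n); last by rewrite mulrSr addrK.
  rewrite IH1 IH2 -!(mulr_natr (q y)) !natrX -[n.+2]addn2 -[n.+1]addn1 !natrD.
  by move: (n%:R : R) => z h; apply: (addIr (q y * z ^+ 2)); rewrite h; ring.
apply/eqP; rewrite -subr_eq0; apply/eqP; move: x.
apply: (@continuous_dyadic_eq0 R (fun x => q x - q 1 * x ^+ 2) 1) => //.
  move=> x; apply: cvgB; first exact: cq.
  by apply: cvgMl_tmp; exact: exprn_continuous.
move=> m n.
have qm (k : int) y : q (y *~ k) = q y * k%:~R ^+ 2.
  case: k => k; first by rewrite -!pmulrn (proj1 (qn k y)) -natrX mulr_natr.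
  by rewrite NegzE !mulrNz qN -!pmulrn (proj2 (qn k y)) sqrrN -natrX mulr_natr.
have h2 : (2 ^+ n : R) != 0 by rewrite expf_neq0.
have E : q (1 / 2 ^+ n) * (2 ^+ n) ^+ 2 = q 1.
  have := qm (Posz (2 ^ n)%N) (1 / 2 ^+ n).
  by rewrite -mulrzr -pmulrn natrX divfK // => ->.
move: E; set y := 1 / _ => E.
have yP : y * 2 ^+ n = 1 by rewrite divfK.
have -> : m%:~R * y = y *~ m by rewrite -[RHS]mulrzr mulrC.
rewrite qm -E -[y *~ m]mulrzr.
have -> : q y * 2 ^+ n ^+ 2 * (y * m%:~R) ^+ 2 = q y * (y * 2 ^+ n) ^+ 2 * m%:~R ^+ 2 by ring.
by rewrite yP; ring.
Qed.

Lemma sqr_eq_Re_pos (R : realType) (z w : R[i]) :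
  z ^+ 2 = w ^+ 2 -> 0 < complex.Re z -> 0 <= complex.Re w -> z = w.
Proof.
move=> /eqP; rewrite eqf_sqr => /orP[/eqP // | /eqP ->].
by case: w => a b /= h1 h2; exfalso; lra.
Qed.

(** Near 0 the real part is positive, so the angle [th] at a small [d] is an arcsine, and repeated
    halving always selects the square root with positive real part. The morphism thus agrees with s
    |-> cis (th s / d) at every d / 2^n, hence at dyadic multiples of [d], hence everywhere by
    continuity. *)
Lemma continuous_circle_morphism (R : realType) (C S : R -> R) :
  continuous C -> continuous S ->
  (forall x y, C (x + y) +i* S (x + y) = (C x +i* S x) * (C y +i* S y)) ->
  (forall x, C x ^+ 2 + S x ^+ 2 = 1) ->
  exists b, forall x, C x = cos (b * x) /\ S x = sin (b * x).
Proof.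
move=> cC cS pD p1; pose p x := C x +i* S x.
have p_neq0 x : p x != 0.
  apply/eqP => -[c0 s0]; have := p1 x; rewrite c0 s0 expr0n /= addr0 => /eqP.
  by rewrite eq_sym oner_eq0.
have p0 : p 0 = 1.
  by apply: (mulIf (p_neq0 0)); rewrite -pD addr0 mul1r.
have C0 : C 0 = 1 by case: p0.
have [d d0 Cd] : exists2 d : R, 0 < d & forall x, `|x| <= d -> 0 < C x.
  have /cvgrPdist_lt /(_ 1 ltr01) := cC 0.
  rewrite C0 => /nbhs_ballP[e /= e0 he].
  exists (e / 2); first by rewrite divr_gt0.
  move=> x xe; have /= := he x; rewrite /ball /= sub0r normrN.
  have : e / 2 < e by lra.
  move=> h /(_ (le_lt_trans xe h)) /ltr_normlW; lra.
have S1 : -1 <= S d <= 1.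
  have := p1 d; rewrite -ler_norml -(@expr_le1 _ 2) // real_normK ?num_real // => <-.
  by rewrite lerDr sqr_ge0.
pose th := asin (S d).
have [/andP[thl thu] Sth] := asin_def S1.
have Cth : cos th = C d.
  rewrite cos_asin // -(p1 d) addrK sqrtr_sqr ger0_norm // ltW //.
  by apply: Cd; rewrite ger0_norm // ltW.
have dn0 n : (0 : R) < 2 ^+ n by rewrite exprn_gt0.
have dn1 n : (1 : R) <= 2 ^+ n by rewrite exprn_ege1 // ler1n.
have root n : p (d / 2 ^+ n) = cis (th / 2 ^+ n).
  elim: n => [|n IH]; first by rewrite expr0 !divr1 /p /cis Cth Sth.
  apply: sqr_eq_Re_pos.
  - rewrite [LHS]expr2 -pD -cisMn -[C _ +i* S _]/(p _).
    rewrite (_ : _ + _ = d / 2 ^+ n); last by rewrite exprSr; field; rewrite gt_eqF.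
    rewrite (_ : th / 2 ^+ n.+1 *+ 2 = th / 2 ^+ n); last by rewrite exprSr; field; rewrite gt_eqF.
    exact: IH.
  - apply: Cd; rewrite gtr0_norm ?divr_gt0 // ler_pdivrMr //.
    by rewrite ler_peMr // ltW.
  - have h : `|th / 2 ^+ n.+1| <= pi / 2.
      rewrite normrM normfV (gtr0_norm (dn0 _)) ler_pdivrMr //.
      have : `|th| <= pi / 2 by rewrite ler_norml -mulNr mulNr thl thu.
      move/le_trans; apply; rewrite ler_peMr // divr_ge0 //.
      exact: pi_ge0.
    by rewrite /= cos_ge0_pihalf // -ler_norml.
pose r x := p x * conjc (cis (th / d * x)).
have rD x y : r (x + y) = r x * r y.
  by rewrite /r {1}/p pD mulrDr cisD rmorphM -!/(p _); ring.
have r_root n : r (d / 2 ^+ n) = 1.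
  rewrite /r root (_ : th / d * _ = th / 2 ^+ n) ?cis_conj //.
  by field; rewrite !gt_eqF.
have r0 : r 0 = 1 by rewrite /r p0 mulr0 cis0 conjc1 mulr1.
have rn x n : r (x *+ n) = r x ^+ n.
  by elim: n => [|n IH]; rewrite ?mulr0n ?r0 ?expr0 // mulrS rD IH exprS.
have r1 (m : int) n : r (m%:~R * (d / 2 ^+ n)) = 1.
  case: m => m; first by rewrite -pmulrn mulr_natl rn r_root expr1n.
  have : r (m.+1%:R * (d / 2 ^+ n)) = 1 by rewrite mulr_natl rn r_root expr1n.
  rewrite NegzE mulrNz -pmulrn mulNr; set y := _ * _ => ry.
  by have := rD y (- y); rewrite subrr r0 ry mul1r.
have cr t : continuous (fun x : R => t * x) by move=> x; apply: cvgMl_tmp; exact: cvg_id.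
have ccos : continuous (fun x => cos (th / d * x)).
  by move=> x; apply: continuous_comp; [exact: cr|exact: continuous_cos].
have csin : continuous (fun x => sin (th / d * x)).
  by move=> x; apply: continuous_comp; [exact: cr|exact: continuous_sin].
have re1 x : C x * cos (th / d * x) + S x * sin (th / d * x) - 1 = 0.
  move: x; apply: (@continuous_dyadic_eq0 _ _ d) => //.
    move=> x; apply: cvgB; last exact: cvg_cst.
    by apply: cvgD; apply: cvgM; solve [exact: cC|exact: cS|exact: ccos|exact: csin].
  by move=> m n; have [h _] := r1 m n; rewrite -[X in _ - X]h; ring.
have im1 x : S x * cos (th / d * x) - C x * sin (th / d * x) = 0.
  move: x; apply: (@continuous_dyadic_eq0 _ _ d) => //.
    by move=> x; apply: cvgB; apply: cvgM; solve [exact: cC|exact: cS|exact: ccos|exact: csin].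
  by move=> m n; have [_ h] := r1 m n; rewrite -[RHS]h; ring.
exists (th / d) => x.
have h1 := re1 x; have h2 := im1 x; have h3 := cos2Dsin2 (th / d * x).
set c := cos _ in h1 h2 h3 *; set s := sin _ in h1 h2 h3 *.
split.
- have -> : C x = C x * (c ^+ 2 + s ^+ 2) by rewrite h3 mulr1.
  have -> : C x * (c ^+ 2 + s ^+ 2) =
    (C x * c + S x * s - 1) * c - (S x * c - C x * s) * s + c by ring.
  by rewrite h1 h2; ring.
- have -> : S x = S x * (c ^+ 2 + s ^+ 2) by rewrite h3 mulr1.
  have -> : S x * (c ^+ 2 + s ^+ 2) =
    (C x * c + S x * s - 1) * s + (S x * c - C x * s) * c + s by ring.
  by rewrite h1 h2; ring.
Qed.

(** The sign of [sigma] is left open; it is recovered afterwards from the bound |F| <= 1. *)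
Definition gaussian_cf (R : realType) (F : R -> R[i]) (sigma b : R) :=
  forall s, F s = (expR (- sigma * s ^+ 2))%:C * cis (b * s).

Lemma complex_mul_conj (R : realType) (z : R[i]) :
  z * conjc z = (complex.Re z ^+ 2 + complex.Im z ^+ 2)%:C.
Proof.
case: z => a b /=; apply/eqP; rewrite eq_complex /=.
by apply/andP; split; apply/eqP; ring.
Qed.

Lemma realcM (R : realType) (x y : R) : (x * y)%:C = x%:C * y%:C.
Proof. exact: rmorphM. Qed.

Lemma conjcM (R : realType) (x y : R[i]) : conjc (x * y) = conjc x * conjc y.
Proof. exact: rmorphM. Qed.

(** The logarithm [q] of |F|^2 satisfies the parallelogram law and is therefore quadratic. The
    quotient p = F / |F| satisfies p (x + y) p (x - y) = p x ^ 2, which makes it a continuous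
    morphism to the circle. *)
Lemma parallelogram_gaussian (R : realType) (F : R -> R[i]) :
  continuous (fun s => complex.Re (F s)) -> continuous (fun s => complex.Im (F s)) ->
  F 0 = 1 -> (forall s, F s != 0) -> (forall s, F (- s) = conjc (F s)) ->
  (forall x y, F (x + y) * F (x - y) = F x ^+ 2 * (F y * F (- y))) ->
  exists sigma b, gaussian_cf F sigma b.
Proof.
move=> cC cS F0 Fn0 FN par.
pose C s := complex.Re (F s); pose S s := complex.Im (F s).
have FE s : F s = C s +i* S s by rewrite /C /S; case: (F s).
pose N s := C s ^+ 2 + S s ^+ 2.
have NE s : F s * conjc (F s) = (N s)%:C by rewrite complex_mul_conj.
have N0 s : 0 < N s.
  rewrite lt0r addr_ge0 ?sqr_ge0 // andbT; apply/eqP => h.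
  have /eqP := NE s; rewrite h mulf_eq0 (negbTE (Fn0 s)) /= => /eqP h'.
  by have := Fn0 s; rewrite -[F s]conjcK h' conjc0 eqxx.
have cN : continuous N.
  have -> : N = fun s => C s * C s + S s * S s by apply: funext => s; rewrite /N !expr2.
  by move=> s; apply: cvgD; apply: cvgM; solve [exact: cC|exact: cS].
have Npar x y : N (x + y) * N (x - y) = N x ^+ 2 * N y ^+ 2.
  have inj (u v : R) : u%:C = v%:C -> u = v by case.
  apply: inj; rewrite !expr2 !realcM -!NE.
  have := par x y; rewrite FN => h.
  have h' : conjc (F (x + y)) * conjc (F (x - y)) =
      conjc (F x) ^+ 2 * (conjc (F y) * F y).
    by rewrite -conjcM h expr2 !conjcM conjcK -expr2.
  by rewrite mulrACA h h'; ring.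
pose q s := ln (N s).
have qE s : q s = q 1 * s ^+ 2.
  apply: continuous_parallelogram => [x|x y].
    by apply: continuous_comp; [exact: cN|exact: continuous_ln].
  rewrite /q -lnM ?posrE // Npar lnM ?posrE ?exprn_gt0 //.
  by rewrite !lnXn.
pose rho s := expR (q s / 2).
have rho0 s : 0 < rho s by exact: expR_gt0.
have rho2 s : rho s ^+ 2 = N s.
  rewrite /rho -expRM_natl; rewrite (_ : 2%:R * (q s / 2) = q s); last by field.
  by rewrite /q lnK ?posrE.
have rhopar x y : rho (x + y) * rho (x - y) = rho x ^+ 2 * rho y ^+ 2.
  rewrite !rho2 /rho -expRD -[N x]lnK ?posrE // -[N y]lnK ?posrE // -expRD.
  congr expR; rewrite -!/(q _) (qE (x + y)) (qE (x - y)) (qE x) (qE y); by field.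
pose p s := F s / (rho s)%:C.
have rhoC s : (rho s)%:C != 0.
  by rewrite eq_complex /= eqxx andbT gt_eqF.
have ppar x y : p (x + y) * p (x - y) = p x ^+ 2.
  rewrite /p mulrACA par FN NE -rho2 -invfM -realcM rhopar.
  rewrite !expr2 !realcM; field; by rewrite !rhoC.
have pE s : p s = (C s / rho s) +i* (S s / rho s).
  rewrite /p FE -fmorphV /=; apply/eqP; rewrite eq_complex /=.
  by apply/andP; split; apply/eqP; ring.
have rho_0 : rho 0 = 1 by rewrite /rho qE expr0n /= mulr0 mul0r expR0.
have p0 : p 0 = 1 by rewrite /p F0 rho_0 divr1.
have p2 x : p (x + x) = p x ^+ 2 by rewrite -(ppar x x) subrr p0 mulr1.
have pD x y : p (x + y) = p x * p y.
  (* The identity [ppar] at the half sum and the half difference, whose sum and difference are x and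
     y. *)
  have {1}-> : x + y = (x + y) / 2 + (x + y) / 2 by field.
  rewrite p2 -(ppar ((x + y) / 2) ((x - y) / 2)); congr (p _ * p _); by field.
have crho : continuous rho.
  move=> s; apply: continuous_comp; last exact: continuous_expR.
  apply: cvgM; last exact: cvg_cst.
  by apply: continuous_comp; [exact: cN|exact: continuous_ln].
have [||||b hb] := @continuous_circle_morphism R (fun s => C s / rho s) (fun s => S s / rho s).
- by move=> s; apply: cvgM; [exact: cC|apply: cvgV; [rewrite gt_eqF|exact: crho]].
- by move=> s; apply: cvgM; [exact: cS|apply: cvgV; [rewrite gt_eqF|exact: crho]].
- by move=> x y; rewrite -!pE.
- by move=> x; rewrite !expr_div_n -mulrDl rho2 -/(N x) mulfV ?lt0r_neq0.
(* Since [q] is the logarithm of the squared modulus, the modulus is exp (q 1 s^2 / 2). *)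
exists (- q 1 / 2), b => s.
rewrite -[LHS](divfK (rhoC s)) -/(p s) pE !(hb s).1 !(hb s).2 mulrC.
congr (_%:C * _); rewrite /rho qE; congr expR; by field.
Qed.

(** * The Heyde equation on the real line *)

Section RealHeyde.
Variables (R : realType) (a : R) (F1 F2 : R -> R[i]).
Hypothesis a0 : a != 0.
Hypothesis aN1 : a != -1.
Hypothesis heyde : forall u v,
  F1 (u + v) * F2 (u + a * v) = F1 (u - v) * F2 (u - a * v).
Hypothesis F1_0 : F1 0 = 1.
Hypothesis F2_0 : F2 0 = 1.
Hypothesis F1_neq0 : forall s, F1 s != 0.
Hypothesis F2_neq0 : forall s, F2 s != 0.
Hypothesis F1N : forall s, F1 (- s) = conjc (F1 s).
Hypothesis F1_le1 : forall s, complex.Re (F1 s) ^+ 2 + complex.Im (F1 s) ^+ 2 <= 1.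
Hypothesis F2_le1 : forall s, complex.Re (F2 s) ^+ 2 + complex.Im (F2 s) ^+ 2 <= 1.
Hypothesis F1_continuous :
  continuous (fun s => complex.Re (F1 s)) /\ continuous (fun s => complex.Im (F1 s)).
Hypothesis F1_unimodular : (forall s, F1 s * conjc (F1 s) = 1) ->
  forall x y, F1 (x + y) = F1 x * F1 y.

(** A cube identity at base point 0 with increments x, y, - y, for arguments t |-> c t evaluated at
    t = 1. Reaching these increments requires division by 1 + a, 2 and 1 - a. *)
Let par_neq1 : a != 1 ->
  forall x y, F1 (x + y) * F1 (x - y) = F1 x ^+ 2 * (F1 y * F1 (- y)).
Proof.
move=> a1 x y.
have h1 : 1 + a != 0 by rewrite addrC -[1]opprK subr_eq0.
have h2 : 1 - a != 0 by rewrite subr_eq0 eq_sym.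
have := @heyde_cube1 R R R[i] (fun t => a * t) (fun u => exists c, u = fun t => c * t)
  (fun u => F1 (u 1)) (fun u => F2 (u 1)) _ _ _ _ _ (fun=> 0) (fun t => x / (1 + a) * t)
  (fun t => y / 2 * t) (fun t => - y / (1 - a) * t) _ _ _ _.
rewrite /cube_identity /= !mulr1.
have -> : x / (1 + a) + x / (1 + a) * a = x by field.
have -> : y / 2 + y / 2 = y by field.
have -> : - y / (1 - a) - - y / (1 - a) * a = - y by field.
rewrite !add0r F1_0 addrK addrN F1_0 => h.
have -> : F1 (x + y) * F1 (x - y) = 1 * F1 (x + y) * F1 (x - y) * 1 by ring.
rewrite -h.
- ring.
- by move=> u v [c ->] [d ->]; exists (c + d); apply: funext => t; ring.
- by move=> u [c ->]; exists (- c); apply: funext => t; ring.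
- by move=> u [c ->]; exists (c * a); apply: funext => t; ring.
- by move=> u v [c ->] [d ->]; rewrite !mulr1 (mulrC d) heyde.
- by move=> u _.
- by exists 0; apply: funext => t; ring.
- by eexists.
- by eexists.
- by eexists.
Qed.

(** Here the third cube increment would vanish. Instead the equation at u = v = s / 2 gives F1 s F2
    s = 1 with both moduli at most 1. Through [F1_unimodular] this makes [F1] multiplicative, so
    that the identity of [par_neq1] persists. *)
Let unimodular_eq1 : a = 1 -> forall s, F1 s * conjc (F1 s) = 1.
Proof.
move=> a1 s; rewrite complex_mul_conj.
have h : F1 s * F2 s = 1.
  have := heyde (s / 2) (s / 2); rewrite a1 mul1r subrr F1_0 F2_0 mulr1.
  by rewrite -splitr.
have : (F1 s * conjc (F1 s)) * (F2 s * conjc (F2 s)) = 1.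
  by rewrite mulrACA -conjcM h conjc1 mulr1.
rewrite !complex_mul_conj -realcM.
move: (F1_le1 s) (F2_le1 s).
have := addr_ge0 (sqr_ge0 (complex.Re (F1 s))) (sqr_ge0 (complex.Im (F1 s))).
have := addr_ge0 (sqr_ge0 (complex.Re (F2 s))) (sqr_ge0 (complex.Im (F2 s))).
move: (_ + _) (_ + _) => n2 n1 ? ? ? ? [e].
by congr (_%:C); nra.
Qed.

Let par1 x y : F1 (x + y) * F1 (x - y) = F1 x ^+ 2 * (F1 y * F1 (- y)).
Proof.
have [a1|/par_neq1 //] := eqVneq a 1.
have h := F1_unimodular (unimodular_eq1 a1).
by rewrite !h expr2; ring.
Qed.

Lemma gaussian_cf_sigma_ge0 (F : R -> R[i]) sigma b : gaussian_cf F sigma b ->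
  (forall s, complex.Re (F s) ^+ 2 + complex.Im (F s) ^+ 2 <= 1) -> 0 <= sigma.
Proof.
move=> /(_ 1) h /(_ 1); rewrite h expr1n !mulr1 /=.
rewrite !mul0r subr0 addr0 !exprMn -mulrDr cos2Dsin2 mulr1.
by rewrite expr_le1 ?expR_ge0 // -expR0 ler_expR oppr_le0.
Qed.

Theorem heyde_gaussian : exists sigma1 b1 sigma2 b2,
  [/\ 0 <= sigma1, 0 <= sigma2, gaussian_cf F1 sigma1 b1 & gaussian_cf F2 sigma2 b2].
Proof.
have [c1 c2] := F1_continuous.
have [sg [b h1]] := parallelogram_gaussian c1 c2 F1_0 F1_neq0 F1N par1.
(* With u = s / 2 and v = s / (2 a) the last factor is F2 0 = 1, so F2 s is the quotient of [F1] at
   u - v and u + v. *)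
have h2 : gaussian_cf F2 (- sg / a) (- b / a).
  move=> s; have := heyde (s / 2) (s / (2 * a)).
  have -> : s / 2 + a * (s / (2 * a)) = s by field.
  have -> : s / 2 - a * (s / (2 * a)) = 0 by field.
  rewrite F2_0 mulr1 !h1 => h.
  have n0 (x y : R) : (expR x)%:C * cis y != 0.
    rewrite mulf_neq0 ?cis_neq0 // eq_complex /= eqxx andbT.
    by rewrite gt_eqF // expR_gt0.
  pose t := s / 2 + s / (2 * a).
  apply: (mulfI (n0 (- sg * t ^+ 2) (b * t))); rewrite h mulrACA -realcM -expRD -cisD /t.
  by congr ((expR _)%:C * cis _); field.
exists sg, b, (- sg / a), (- b / a); split=> //.
  exact: (gaussian_cf_sigma_ge0 h1).
exact: (gaussian_cf_sigma_ge0 h2).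
Qed.

End RealHeyde.

(** * Characteristic functions *)

Section Expectation.
Context d (Omega : measurableType d) (R : realType) (P : probability Omega R).
Implicit Types f g Z : Omega -> R.

Lemma bounded_integrable f M : measurable_fun setT f -> (forall w, `|f w| <= M) ->
  P.-integrable setT (EFin \o f).
Proof.
move=> mf fM; apply: measurable_bounded_integrable => //.
  by rewrite ltey_eq fin_num_measure.
exists M; split; first exact: num_real.
by move=> y My w _; exact: le_trans (fM w) (ltW My).
Qed.

Lemma Rexpectation_cst r : \int[P]_w r = r.
Proof. by rewrite Rintegral_cst // [X in fine X](@probability_setT _ _ _ P) mulr1. Qed.

Lemma ae_eq_Rintegral f g :
  measurable_fun setT f -> measurable_fun setT g ->
  {ae P, forall w, f w = g w} -> \int[P]_w f w = \int[P]_w g w.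
Proof.
move=> mf mg fg; congr fine; apply: ae_eq_integral => //.
- exact/measurable_EFinP.
- exact/measurable_EFinP.
- by apply: filterS fg => w h _ /=; rewrite h.
Qed.

Lemma bounded_cvg_Rintegral (f_ : nat -> Omega -> R) f M :
  (forall n, measurable_fun setT (f_ n)) ->
  (forall n w, `|f_ n w| <= M) ->
  (forall w, f_ n w @[n --> \oo] --> f w) ->
  \int[P]_w f_ n w @[n --> \oo] --> \int[P]_w f w.
Proof.
move=> mf bf cf; rewrite /Rintegral.
have mf0 : measurable_fun setT f.
  by apply: (measurable_fun_cvg mf) => w _; exact: cf.
have fM w : `|f w| <= M.
  apply: (closed_cvg _ (@closed_le _ M) _ _ (cvg_norm (cf w))).
  by apply: nearW => n; exact: bf.
apply: fine_cvg; rewrite fineK; last first.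
  by apply: integrable_fin_num => //; exact: bounded_integrable fM.
apply: (@dominated_cvg _ _ _ P setT measurableT (fun n w => (f_ n w)%:E)
   (fun w => (f w)%:E) (fun=> M%:E)) => //.
- by move=> n; exact/measurable_EFinP.
- by move=> w _; apply: cvg_EFin; [exact: nearW|exact: cf].
- by apply: (@bounded_integrable (fun=> M) `|M|) => // w.
- by move=> n w _; rewrite lee_fin.
Qed.

(** The expectation of e^{iZ}. Taking Z = s X + theta (Y) gives the values of characteristic
    functions on R, on G and on R x G alike. *)
Definition cf Z : R[i] := (\int[P]_w cos (Z w)) +i* (\int[P]_w sin (Z w)).

Lemma measurable_cosr Z : measurable_fun setT Z -> measurable_fun setT (fun w => cos (Z w)).
Proof.
move=> mZ; apply: measurableT_comp mZ; apply: continuous_measurable_fun.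
exact: continuous_cos.
Qed.

Lemma measurable_sinr Z : measurable_fun setT Z -> measurable_fun setT (fun w => sin (Z w)).
Proof.
move=> mZ; apply: measurableT_comp mZ; apply: continuous_measurable_fun.
exact: continuous_sin.
Qed.

Lemma normr_cos_le1 (x : R) : `|cos x| <= 1.
Proof. by rewrite ler_norml cos_geN1 cos_le1. Qed.

Lemma normr_sin_le1 (x : R) : `|sin x| <= 1.
Proof. by rewrite ler_norml sin_geN1 sin_le1. Qed.

Lemma integrable_cos Z : measurable_fun setT Z -> P.-integrable setT (EFin \o (fun w => cos (Z w))).
Proof.
move=> mZ; apply: (@bounded_integrable _ 1) => [|w]; first exact: measurable_cosr.
exact: normr_cos_le1.
Qed.

Lemma integrable_sin Z : measurable_fun setT Z -> P.-integrable setT (EFin \o (fun w => sin (Z w))).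
Proof.
move=> mZ; apply: (@bounded_integrable _ 1) => [|w]; first exact: measurable_sinr.
exact: normr_sin_le1.
Qed.

Lemma cf_eq Z Z' : (forall w, cis (Z w) = cis (Z' w)) -> cf Z = cf Z'.
Proof.
by move=> h; rewrite /cf; congr (_ +i* _); apply: eq_Rintegral => w _; case: (h w).
Qed.

Lemma cf0 : cf (fun=> 0) = 1.
Proof.
rewrite /cf; congr (_ +i* _).
  by rewrite (_ : (fun=> _) = cst 1) ?Rexpectation_cst //; apply: funext => w; rewrite cos0.
by rewrite (_ : (fun=> _) = cst 0) ?Rexpectation_cst //; apply: funext => w; rewrite sin0.
Qed.

Lemma cfN Z : measurable_fun setT Z -> cf (fun w => - Z w) = conjc (cf Z).
Proof.
move=> mZ; rewrite /cf /=; congr (_ +i* _).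
  by apply: eq_Rintegral => w _; rewrite cosN.
rewrite -mulN1r -RintegralZl //; last exact: integrable_sin.
by apply: eq_Rintegral => w _; rewrite sinN mulN1r.
Qed.

Lemma Rintegral_lin2 f g a b M N : measurable_fun setT f -> measurable_fun setT g ->
  (forall w, `|f w| <= M) -> (forall w, `|g w| <= N) ->
  \int[P]_w (a * f w + b * g w) = a * \int[P]_w f w + b * \int[P]_w g w.
Proof.
move=> mf mg fM gN.
have if_ := bounded_integrable mf fM; have ig := bounded_integrable mg gN.
rewrite RintegralD //.
- by rewrite !RintegralZl.
- by apply: (@bounded_integrable _ (`|a| * M)) => [|w];
    [exact: measurable_funM|rewrite normrM ler_wpM2l].
- by apply: (@bounded_integrable _ (`|b| * N)) => [|w];
    [exact: measurable_funM|rewrite normrM ler_wpM2l].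
Qed.

Lemma ae_cf_shift Z Z' c : measurable_fun setT Z -> measurable_fun setT Z' ->
  {ae P, forall w, cis (Z' w) = cis (Z w) * c} -> cf Z' = cf Z * c.
Proof.
case: c => a b mZ mZ' h; rewrite /cf.
have [mc ms] := (measurable_cosr mZ, measurable_sinr mZ).
have mlin u v : measurable_fun setT (fun w => u * cos (Z w) + v * sin (Z w)).
  by apply: measurable_funD; apply: measurable_funM.
rewrite (@ae_eq_Rintegral _ (fun w => a * cos (Z w) + - b * sin (Z w))) //; last 2 first.
- exact: measurable_cosr.
- by apply: filterS h => w [-> _]; ring.
rewrite [in X in _ +i* X](@ae_eq_Rintegral _
  (fun w => b * cos (Z w) + a * sin (Z w))) //; last 2 first.
- exact: measurable_sinr.
- by apply: filterS h => w [_ ->]; ring.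
rewrite !(@Rintegral_lin2 _ _ _ _ 1 1) //; try by move=> w; rewrite ?normr_cos_le1 ?normr_sin_le1.
by apply/eqP; rewrite eq_complex /=; apply/andP; split; apply/eqP; ring.
Qed.

(* [E |e^{iZ} - E e^{iZ}|^2 = 1 - |E e^{iZ}|^2]. *)
Lemma cf_variance Z : measurable_fun setT Z ->
  \int[P]_w ((cos (Z w) - complex.Re (cf Z)) ^+ 2 + (sin (Z w) - complex.Im (cf Z)) ^+ 2) =
  1 - (complex.Re (cf Z) ^+ 2 + complex.Im (cf Z) ^+ 2).
Proof.
move=> mZ; set a := complex.Re _; set b := complex.Im _.
have [mc ms] := (measurable_cosr mZ, measurable_sinr mZ).
rewrite (@eq_Rintegral _ _ _ _ _ (fun w => (1 + a ^+ 2 + b ^+ 2) * 1 +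
  -2 * (a * cos (Z w) + b * sin (Z w)))); last first.
  by move=> w _; have := cos2Dsin2 (Z w) => h; rewrite -{1}h; ring.
have ml : measurable_fun setT (fun w => a * cos (Z w) + b * sin (Z w)).
  by apply: measurable_funD; apply: measurable_funM.
rewrite (@Rintegral_lin2 _ _ _ _ 1 (`|a| + `|b|)) //.
- rewrite (@Rintegral_lin2 _ _ _ _ 1 1) //; try by move=> w; rewrite ?normr_cos_le1 ?normr_sin_le1.
  rewrite Rexpectation_cst -[\int[P]_w cos _]/a -[\int[P]_w sin _]/b; ring.
- by move=> w; rewrite normr1.
- move=> w; apply: le_trans (ler_normD _ _) _; rewrite !normrM lerD //.
    by rewrite ler_piMr // normr_cos_le1.
  by rewrite ler_piMr // normr_sin_le1.
Qed.

Lemma cf_le1 Z : measurable_fun setT Z ->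
  complex.Re (cf Z) ^+ 2 + complex.Im (cf Z) ^+ 2 <= 1.
Proof.
move=> mZ; rewrite -subr_ge0 -cf_variance //; apply: Rintegral_ge0 => w _.
by rewrite addr_ge0 // sqr_ge0.
Qed.

(** By [cf_variance] the nonnegative function |e^{iZ} - E e^{iZ}|^2 has integral 0. *)
Lemma cf_unimodular Z : measurable_fun setT Z ->
  complex.Re (cf Z) ^+ 2 + complex.Im (cf Z) ^+ 2 = 1 ->
  {ae P, forall w, cis (Z w) = cf Z}.
Proof.
move=> mZ h1.
set a := complex.Re (cf Z) in h1 *; set b := complex.Im (cf Z) in h1 *.
pose V w := (cos (Z w) - a) ^+ 2 + (sin (Z w) - b) ^+ 2.
have [mc ms] := (measurable_cosr mZ, measurable_sinr mZ).
have mV : measurable_fun setT V.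
  by apply: measurable_funD; apply: measurable_funX; apply: measurable_funB.
have V0 w : 0 <= V w by rewrite addr_ge0 // sqr_ge0.
have VM w : `|V w| <= 2 + 2 * (a ^+ 2 + b ^+ 2).
  rewrite ger0_norm // /V.
  have := cos2Dsin2 (Z w); have := sqr_ge0 (cos (Z w) + a); have := sqr_ge0 (sin (Z w) + b).
  nra.
have iV : (\int[P]_w (V w)%:E = 0)%E.
  rewrite -[LHS]fineK; last by apply: integrable_fin_num => //; exact: bounded_integrable VM.
  by congr (_%:E); rewrite -[LHS]/(\int[P]_w V w) /V cf_variance // -/a -/b h1 subrr.
have : (\int[P]_w `|(V w)%:E| = 0)%E.
  by rewrite -[RHS]iV; apply: eq_integral => w _; rewrite gee0_abs // lee_fin.
move/ae_eq_integral_abs => /(_ measurableT) h.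
have := h; move=> /(_ _) H; have {H} := H ltac:(exact/measurable_EFinP).
apply: filterS => w /(_ I) /= [] /eqP; rewrite /V paddr_eq0 ?sqr_ge0 //.
rewrite !sqrf_eq0 !subr_eq0 => /andP[/eqP c /eqP s].
by rewrite /cis c s /a /b; case: (cf Z).
Qed.

Lemma continuous_cf Z : measurable_fun setT Z ->
  continuous (fun s : R => complex.Re (cf (fun w => s * Z w))) /\
  continuous (fun s : R => complex.Im (cf (fun w => s * Z w))).
Proof.
move=> mZ.
have ms s : measurable_fun setT (fun w => s * Z w) by exact: measurable_funM.
have cm z : continuous (fun s : R => s * z) by move=> s; apply: cvgMr_tmp; exact: cvg_id.
suff H (h : R -> R) : continuous h -> (forall x, `|h x| <= 1) ->
    continuous (fun s : R => \int[P]_w h (s * Z w)).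
  by split; apply: H; solve [exact: continuous_cos|exact: continuous_sin|
    exact: normr_cos_le1|exact: normr_sin_le1].
move=> ch h1 s; apply/(@cvg_nbhsP _ R^o) => u us.
apply: (@bounded_cvg_Rintegral _ _ 1) => [n|n w|w]; last 2 first.
- exact: h1.
- apply: continuous_cvg; first exact: ch.
  exact: (continuous_cvg _ (cm (Z w) s) us).
by apply: measurableT_comp (ms (u n)); exact: continuous_measurable_fun.
Qed.

End Expectation.

(** Independence on rectangles identifies the joint law with the product of the marginal laws, and
    Fubini applies. *)
Lemma Rintegral_indep d d1 d2 (Omega : measurableType d) (T1 : measurableType d1)
    (T2 : measurableType d2) (R : realType) (P : probability Omega R)
    (X : {mfun Omega >-> T1}) (Y : {mfun Omega >-> T2})
    (phi : T1 -> R) (psi : T2 -> R) :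
  (forall A B, measurable A -> measurable B ->
     P (X @^-1` A `&` Y @^-1` B) = (P (X @^-1` A) * P (Y @^-1` B))%E) ->
  measurable_fun setT phi -> measurable_fun setT psi ->
  (forall x, `|phi x| <= 1) -> (forall y, `|psi y| <= 1) ->
  \int[P]_w (phi (X w) * psi (Y w)) = \int[P]_w phi (X w) * \int[P]_w psi (Y w).
Proof.
move=> ind mphi mpsi phi1 psi1.
have mXY : measurable_fun setT (fun w => (X w, Y w)) by exact: measurable_fun_pair.
pose XY : {mfun Omega >-> (T1 * T2)%type} :=
  HB.pack (fun w => (X w, Y w)) (isMeasurableFun.Build _ _ _ _ _ mXY).
pose m1 := distribution P X; pose m2 := distribution P Y; pose m := distribution P XY.
pose f (z : T1 * T2) : R := phi z.1 * psi z.2.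
have mf : measurable_fun setT f.
  by apply: measurable_funM; apply: measurableT_comp.
have f1 z : `|f z| <= 1 by rewrite normrM mulr_ile1.
have ibnd d0 (T : measurableType d0) (Q : probability T R) (g : T -> R) :
    measurable_fun setT g -> (forall t, `|g t| <= 1) -> Q.-integrable setT (EFin \o g).
  by move=> mg g1; exact: (bounded_integrable Q mg g1).
have E1 : (\int[P]_w (f (XY w))%:E = \int[m]_z (f z)%:E)%E.
  rewrite integral_distribution //; first exact/measurable_EFinP.
  by apply: (@ibnd _ _ P (f \o XY)) => [|w]; [exact: (measurableT_comp mf mXY)|exact: f1].
have E2 : (\int[m]_z (f z)%:E = \int[m1 \x m2]_z (f z)%:E)%E.
  apply: eq_measure_integral => A mA _; apply/esym.
  by apply: product_measure_unique => // A1 A2 mA1 mA2; rewrite -ind.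
have if12 : (m1 \x m2)%E.-integrable setT (fun z => (f z)%:E).
  have [mf' h] := integrableP _ _ _ (@ibnd _ _ m f mf f1).
  apply/integrableP; split=> //.
  rewrite (eq_measure_integral m) // => A mA _.
  by apply: product_measure_unique => // A1 A2 mA1 mA2; rewrite -ind.
have E3 : (\int[m1 \x m2]_z (f z)%:E = \int[m1]_x \int[m2]_y (f (x, y))%:E)%E.
  by rewrite -integral12_prod_meas1.
have ipsi : m2.-integrable setT (EFin \o psi) by exact: ibnd.
have iphi : m1.-integrable setT (EFin \o phi) by exact: ibnd.
have E4 : (\int[m1]_x \int[m2]_y (f (x, y))%:E =
   \int[m1]_x (phi x)%:E * \int[m2]_y (psi y)%:E)%E.
  have fin2 := integrable_fin_num measurableT ipsi.
  rewrite -(fineK fin2) -integralZr //; apply: eq_integral => x _.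
  rewrite fineK // -integralZl //.
rewrite /Rintegral [in LHS](_ : (\int[P]_w _)%E = (\int[P]_w (f (XY w))%:E)%E) //.
rewrite E1 E2 E3 E4.
have -> : (\int[P]_w (phi (X w))%:E = \int[m1]_x (phi x)%:E)%E.
  rewrite integral_distribution //; first exact/measurable_EFinP.
  by apply: (@ibnd _ _ P (phi \o X)) => [|w]; [exact: measurableT_comp|exact: phi1].
have -> : (\int[P]_w (psi (Y w))%:E = \int[m2]_x (psi x)%:E)%E.
  rewrite integral_distribution //; first exact/measurable_EFinP.
  by apply: (@ibnd _ _ P (psi \o Y)) => [|w]; [exact: measurableT_comp|exact: psi1].
by rewrite fineM //; exact: integrable_fin_num.
Qed.

(** * Factorization of characteristic functions implies independence *)

Section TrigPoly.
Variables (R : realType) (T : Type) (L : (T -> R) -> Prop).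

(** The free phase [c] supplies the sines and, for the zero argument, the constants. *)
Inductive trigpoly : (T -> R) -> Prop :=
| trigpoly_cos phi c of L phi : trigpoly (fun t => cos (phi t + c))
| trigpoly_lin a b f g of trigpoly f & trigpoly g :
    trigpoly (fun t => a * f t + b * g t).

Hypothesis LD : forall u v, L u -> L v -> L (fun t => u t + v t).
Hypothesis LN : forall u, L u -> L (fun t => - u t).
Hypothesis L0 : L (fun=> 0).

Lemma trigpoly_cst c : trigpoly (fun=> c).
Proof.
have := trigpoly_lin c 0 (trigpoly_cos 0 L0) (trigpoly_cos 0 L0).
by rewrite addr0 cos0 mulr1 mul0r addr0.
Qed.

Lemma trigpolyM f g : trigpoly f -> trigpoly g -> trigpoly (fun t => f t * g t).
Proof.
elim=> {f} [phi c Lphi|a b f1 f2 _ IH1 _ IH2] Hg; last first.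
  rewrite (_ : (fun t => _) = fun t => a * (f1 t * g t) + b * (f2 t * g t)).
    by apply: trigpoly_lin; [exact: IH1|exact: IH2].
  by apply: funext => t; ring.
elim: Hg => {g} [psi e Lpsi|a b g1 g2 _ IH1 _ IH2]; last first.
  rewrite (_ : (fun t => _) = fun t =>
    a * (cos (phi t + c) * g1 t) + b * (cos (phi t + c) * g2 t)).
    by apply: trigpoly_lin.
  by apply: funext => t; ring.
rewrite (_ : (fun t => _) = fun t => 2^-1 * cos (phi t + psi t + (c + e)) +
  2^-1 * cos (phi t + - psi t + (c - e))).
  by apply: trigpoly_lin; apply: trigpoly_cos; apply: LD => //; exact: LN.
apply: funext => t.
rewrite (_ : phi t + psi t + _ = (phi t + c) + (psi t + e)); last by ring.
rewrite (_ : phi t - psi t + _ = (phi t + c) - (psi t + e)); last by ring.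
by move: (_ + c) (_ + e) => u v; rewrite cosD cosB; field.
Qed.

End TrigPoly.

Section Factorization.
Context d (Omega : measurableType d) (R : realType) (P : probability Omega R).
Variables (T1 T2 : Type) (L1 : (T1 -> R) -> Prop) (L2 : (T2 -> R) -> Prop).
Variables (X : Omega -> T1) (Y : Omega -> T2).
Hypothesis L1_measurable : forall phi, L1 phi -> measurable_fun setT (phi \o X).
Hypothesis L2_measurable : forall psi, L2 psi -> measurable_fun setT (psi \o Y).
Hypothesis L2N : forall u, L2 u -> L2 (fun t => - u t).
Hypothesis cf_factor : forall phi psi, L1 phi -> L2 psi ->
  cf P (fun w => phi (X w) + psi (Y w)) =
  cf P (fun w => phi (X w)) * cf P (fun w => psi (Y w)).

Lemma trigpoly_measurable_bounded (T : Type) (L : (T -> R) -> Prop) (Z : Omega -> T) f :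
  (forall phi, L phi -> measurable_fun setT (phi \o Z)) -> trigpoly L f ->
  measurable_fun setT (f \o Z) /\ exists M, forall w, `|f (Z w)| <= M.
Proof.
move=> mL; elim=> {f} [phi c Lphi|a b f g _ [mf [M fM]] _ [mg [N gN]]].
  split; last by exists 1 => w; exact: normr_cos_le1.
  apply: (@measurable_cosr _ _ _ (fun w => phi (Z w) + c)).
  by apply: measurable_funD => //; exact: mL.
split; first by apply: measurable_funD; apply: measurable_funM.
exists (`|a| * M + `|b| * N) => w; apply: le_trans (ler_normD _ _) _.
by rewrite !normrM lerD // ler_wpM2l.
Qed.

Lemma Rintegral_cosD (Z : Omega -> R) c : measurable_fun setT Z ->
  \int[P]_w cos (Z w + c) = complex.Re (cf P Z * cis c).
Proof.
move=> mZ; rewrite -(@ae_cf_shift _ _ _ _ Z (fun w => Z w + c) (cis c)) //.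
- exact: measurable_funD.
- by apply: nearW => w; rewrite cisD.
Qed.

(** By bilinearity it suffices to treat two cosines. Their product is half the sum of the cosines of
    the sum and of the difference of the arguments, and [cf_factor] applies to both; the difference
    is why [L2] is closed under negation. *)
Lemma trigpoly_factor f g : trigpoly L1 f -> trigpoly L2 g ->
  \int[P]_w (f (X w) * g (Y w)) = \int[P]_w f (X w) * \int[P]_w g (Y w).
Proof.
elim=> {f} [phi c Lphi|a b f1 f2 hf1 IH1 hf2 IH2] Hg; last first.
  have [mf1 [M1 b1]] := trigpoly_measurable_bounded L1_measurable hf1.
  have [mf2 [M2 b2]] := trigpoly_measurable_bounded L1_measurable hf2.
  have [mg [N bg]] := trigpoly_measurable_bounded L2_measurable Hg.
  rewrite (@eq_Rintegral _ _ _ _ _ (fun w => a * (f1 (X w) * g (Y w)) + b * (f2 (X w) * g (Y w)))).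
    rewrite (@Rintegral_lin2 _ _ _ _ _ _ _ _ (M1 * N) (M2 * N)).
    - by rewrite IH1 // IH2 // (@Rintegral_lin2 _ _ _ _ _ _ _ _ M1 M2) //; ring.
    - exact: measurable_funM.
    - exact: measurable_funM.
    - by move=> w; rewrite normrM ler_pM.
    - by move=> w; rewrite normrM ler_pM.
  by move=> w _; ring.
elim: Hg => {g} [psi e Lpsi|a b f1 f2 hf1 IH1 hf2 IH2]; last first.
  have [mf1 [M1 b1]] := trigpoly_measurable_bounded L2_measurable hf1.
  have [mf2 [M2 b2]] := trigpoly_measurable_bounded L2_measurable hf2.
  have [mg [N bg]] := trigpoly_measurable_bounded L1_measurable (trigpoly_cos c Lphi).
  rewrite (@eq_Rintegral _ _ _ _ _ (fun w => a * (cos (phi (X w) + c) * f1 (Y w)) +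
     b * (cos (phi (X w) + c) * f2 (Y w)))).
    rewrite (@Rintegral_lin2 _ _ _ _ _ _ _ _ (N * M1) (N * M2)).
    - by rewrite IH1 // IH2 // (@Rintegral_lin2 _ _ _ _ _ _ _ _ M1 M2) //; ring.
    - exact: measurable_funM.
    - exact: measurable_funM.
    - by move=> w; rewrite normrM ler_pM.
    - by move=> w; rewrite normrM ler_pM.
  by move=> w _; ring.
have mphi := L1_measurable Lphi; have mpsi := L2_measurable Lpsi.
have mD : measurable_fun setT (fun w => phi (X w) + psi (Y w)) by exact: measurable_funD.
have mB : measurable_fun setT (fun w => phi (X w) + - psi (Y w)).
  by apply: measurable_funD => //; exact: (L2_measurable (L2N Lpsi)).
rewrite (@eq_Rintegral _ _ _ _ _ (fun w => 2^-1 * cos (phi (X w) + psi (Y w) + (c + e)) +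
  2^-1 * cos (phi (X w) + - psi (Y w) + (c - e)))); last first.
  move=> w _.
  rewrite (_ : phi _ + psi _ + _ = (phi (X w) + c) + (psi (Y w) + e)); last by ring.
  rewrite (_ : phi _ - psi _ + _ = (phi (X w) + c) - (psi (Y w) + e)); last by ring.
  by move: (_ + c) (_ + e) => u v; rewrite cosD cosB; field.
rewrite (@Rintegral_lin2 _ _ _ _ _ _ _ _ 1 1); last 4 first.
- by apply: (@measurable_cosr _ _ _ (fun w => _ + _)); exact: measurable_funD.
- by apply: (@measurable_cosr _ _ _ (fun w => _ + _)); exact: measurable_funD.
- by move=> w; exact: normr_cos_le1.
- by move=> w; exact: normr_cos_le1.
rewrite !Rintegral_cosD // cf_factor //.
rewrite (@cf_factor phi (fun t => - psi t)) //; last exact: L2N.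
rewrite (cfN _ mpsi) !cisD cisN.
case: (cf P _) => a1 b1; case: (cf P _) => a2 b2; by rewrite /cis /=; field.
Qed.

End Factorization.

(** Lagrange interpolation: for each g other than g0, the function 1 - cos (theta - theta g)
    vanishes at g but not at g0 if theta separates them. The product over all such g is divided by
    its value at g0. *)
Lemma trigpoly_indic (R : realType) (G : finZmodType) (L : (G -> R) -> Prop) (g0 : G) :
  (forall u v, L u -> L v -> L (fun t => u t + v t)) ->
  (forall u, L u -> L (fun t => - u t)) -> L (fun=> 0) ->
  (forall g, g != g0 -> exists2 theta, L theta & cis (theta g0 - theta g) != 1) ->
  trigpoly L (fun g => (g == g0)%:R).
Proof.
move=> LD LN L0 sep.
have sep1 g : exists f, [/\ trigpoly L f, f g0 != 0 & (g != g0 -> f g = 0)].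
  have [->|/sep [th Lth hth]] := eqVneq g g0.
    by exists (fun=> 1); split; [exact: trigpoly_cst|exact: oner_neq0|].
  exists (fun t => 1 * 1 + -1 * cos (th t + - th g)); split.
  - by apply: trigpoly_lin; [exact: trigpoly_cst|exact: trigpoly_cos].
  - apply: contra_neq hth => h.
    have c1 : cos (th g0 - th g) = 1 by move: h; rewrite mulr1 mulN1r; lra.
    have := cos2Dsin2 (th g0 - th g); rewrite c1 expr1n -[RHS]addr0 => /addrI/eqP.
    by rewrite sqrf_eq0 /cis c1 => /eqP ->.
  - by move=> _; rewrite addrN cos0; ring.
have [F hF] := choice sep1.
have hs (s : seq G) : exists f, [/\ trigpoly L f, f g0 != 0 &
    forall g, g \in s -> g != g0 -> f g = 0].
  elim: s => [|g s [f [tf f0 fs]]].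
    by exists (fun=> 1); split; [exact: trigpoly_cst|exact: oner_neq0|].
  have [tF F0 Fg] := hF g.
  exists (fun t => F g t * f t); split.
  - exact: trigpolyM.
  - by rewrite mulf_neq0.
  - move=> h; rewrite inE => /orP[/eqP -> /Fg ->|hs hg]; first by rewrite mul0r.
    by rewrite fs // mulr0.
have [f [tf f0 fs]] := hs (index_enum G).
rewrite (_ : (fun g => _) = fun g => (f g0)^-1 * f g + 0 * 1).
  by apply: trigpoly_lin => //; exact: trigpoly_cst.
apply: funext => g; have [->|h] := eqVneq g g0; first by rewrite mulVf // mul0r addr0.
by rewrite (fs g) ?mem_index_enum // mulr0 mul0r addr0.
Qed.

Lemma trigpoly_finite (R : realType) (G : finZmodType) (L : (G -> R) -> Prop) (f : G -> R) :
  (forall u v, L u -> L v -> L (fun t => u t + v t)) ->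
  (forall u, L u -> L (fun t => - u t)) -> L (fun=> 0) ->
  (forall g g0, g != g0 -> exists2 theta, L theta & cis (theta g0 - theta g) != 1) ->
  trigpoly L f.
Proof.
move=> LD LN L0 sep.
have -> : f = fun g => \sum_(h <- index_enum G) f h * (g == h)%:R.
  apply: funext => g; rewrite (bigD1 g) //= eqxx mulr1 big1 ?addr0 // => h.
  by rewrite eq_sym => /negPf ->; rewrite mulr0.
elim: (index_enum G) => [|h s IH].
  under eq_fun do rewrite big_nil.
  exact: trigpoly_cst.
under eq_fun do rewrite big_cons -[X in _ + X]mul1r.
apply: trigpoly_lin => //; apply: trigpoly_indic => // g; exact: sep.
Qed.

(** * Approximation of the sign function by trigonometric polynomials *)

Section SignApproximation.
Variable R : realType.

(* A polynomial map of [-1, 1] with attracting fixed points -1 and 1: its iterates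
   at sin(delta (t - x)) are trigonometric polynomials in t, and letting first the
   number of iterations and then 1/delta tend to infinity gives sg(t - x). *)
Definition smooth_sign_step (y : R) := (3 * y - y ^+ 3) / 2.

Fixpoint smooth_sign n (y : R) :=
  if n is n'.+1 then smooth_sign_step (smooth_sign n' y) else y.

Lemma smooth_signN n y : smooth_sign n (- y) = - smooth_sign n y.
Proof. by elim: n => [|n /= ->] //; rewrite /smooth_sign_step; field. Qed.

Lemma smooth_sign0 n : smooth_sign n 0 = 0.
Proof. by elim: n => [|n /= ->] //; rewrite /smooth_sign_step; field. Qed.

(** One step turns 1 - u into (1 - u)^2 (u + 2) / 2. The iterates never fall below y, so each step
    contracts the distance to 1 at least by the factor 1 - y / 2. *)
Lemma smooth_sign_pos n y : 0 < y <= 1 ->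
  [/\ y <= smooth_sign n y, smooth_sign n y <= 1 &
      1 - smooth_sign n y <= (1 - y / 2) ^+ n].
Proof.
move=> /andP[y0 y1]; elim: n => [|n [h1 h2 h3]] /=; first by split => //; lra.
set u := smooth_sign n y in h1 h2 h3 *.
have E : 1 - smooth_sign_step u = (1 - u) * ((2 - u - u ^+ 2) / 2).
  by rewrite /smooth_sign_step; field.
have u0 : 0 < u by lra.
have f0 : 0 <= (2 - u - u ^+ 2) / 2 by nra.
have f1 : (2 - u - u ^+ 2) / 2 <= 1 - y / 2 by nra.
split.
- by rewrite /smooth_sign_step; nra.
- by rewrite -subr_ge0 E mulr_ge0 // subr_ge0.
- by rewrite E (exprSr (1 - y / 2)) ler_pM // subr_ge0.
Qed.

Lemma smooth_sign_le1 n y : `|y| <= 1 -> `|smooth_sign n y| <= 1.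
Proof.
move=> y1; have [y0|y0|->] := ltrgt0P y; last by rewrite smooth_sign0 normr0.
- have [|h1 h2 _] := @smooth_sign_pos n y.
    by rewrite y0 /= (le_trans (ler_norm y) y1).
  by rewrite ger0_norm // (le_trans (ltW y0)).
- have [|h1 h2 _] := @smooth_sign_pos n (- y).
    by rewrite oppr_gt0 y0 /= (le_trans (ler_norm (- y))) ?normrN.
  rewrite -normrN -smooth_signN ger0_norm // (le_trans _ h1) // oppr_ge0 ltW //.
Qed.

Lemma smooth_sign_cvg y : `|y| <= 1 -> smooth_sign n y @[n --> \oo] --> Num.sg y.
Proof.
have pos z : 0 < z <= 1 -> smooth_sign n z @[n --> \oo] --> (1 : R).
  move=> z01; have /andP[z0 z1] := z01.
  apply/cvgrPdist_le => e e0.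
  have lim : (1 - z / 2) ^+ n @[n --> \oo] --> (0 : R).
    by apply: cvg_expr; rewrite ger0_norm; lra.
  move/cvgrPdist_le : lim => /(_ e e0); apply: filterS => n.
  have [h1 h2 h3] := smooth_sign_pos n z01.
  rewrite sub0r normrN => h; rewrite ger0_norm ?subr_ge0 //.
  by apply: le_trans h3 _; apply: le_trans (ler_norm _) h.
move=> y1; have [y0|y0|->] := ltrgt0P y.
- by rewrite gtr0_sg //; apply: pos; rewrite y0 (le_trans (ler_norm y) y1).
- rewrite ltr0_sg // (_ : (fun n => _) = fun n => - smooth_sign n (- y)).
    by apply: cvgN; apply: pos; rewrite oppr_gt0 y0 /= (le_trans (ler_norm (- y))) ?normrN.
  by apply: funext => n; rewrite smooth_signN opprK.
- rewrite sgr0 (_ : (fun n => _) = cst 0); first exact: cvg_cst.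
  by apply: funext => n; rewrite smooth_sign0.
Qed.

Lemma trigpoly_smooth_sign T (L : (T -> R) -> Prop) n f :
  (forall u v, L u -> L v -> L (fun t => u t + v t)) ->
  (forall u, L u -> L (fun t => - u t)) -> L (fun=> 0) ->
  trigpoly L f -> trigpoly L (fun t => smooth_sign n (f t)).
Proof.
move=> LD LN L0 Lf; elim: n => [|n IH] //=.
rewrite (_ : (fun t => _) = fun t => (3 / 2) * smooth_sign n (f t) +
  - 2^-1 * (smooth_sign n (f t) * (smooth_sign n (f t) * smooth_sign n (f t)))).
  by apply: trigpoly_lin => //; apply: trigpolyM => //; apply: trigpolyM.
by apply: funext => t; rewrite /smooth_sign_step; field.
Qed.

Lemma sg_sin_cvg (u : R) : Num.sg (sin (u / n.+1%:R)) @[n --> \oo] --> Num.sg u.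
Proof.
have pos (v : R) : 0 < v -> \forall n \near \oo, Num.sg (sin (v / n.+1%:R)) = 1.
  move=> v0; near=> n; rewrite gtr0_sg //; apply: sin2_gt0.
  rewrite divr_gt0 //= ltr_pdivrMr //.
  have : v <= n%:R by near: n; exact: nbhs_infty_ger.
  by rewrite -natr1; lra.
apply: cvg_near_cst; have [u0|u0|->] := ltrgt0P u.
- by rewrite gtr0_sg //; exact: pos.
- rewrite ltr0_sg //; have := pos (- u); rewrite oppr_gt0 => /(_ u0).
  by apply: filterS => n; rewrite mulNr sinN sgrN => /(canRL (@opprK _)).
- by apply: nearW => n; rewrite mul0r sin0.
Unshelve. all: by end_near. Qed.

(** Moving the threshold to x from the right removes the value 0 of the sign at t = x, so the limit
    takes only two values and encodes the ray []x, +oo[]. *)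
Lemma sg_right_cvg (t x : R) :
  Num.sg (t - (x + n.+1%:R^-1)) @[n --> \oo] --> (if t <= x then -1 else 1 : R).
Proof.
apply: cvg_near_cst; case: ifPn => [tx|].
  apply: nearW => n; rewrite ltr0_sg // subr_lt0 (le_lt_trans tx) // ltrDl invr_gt0.
  by rewrite ltr0n.
rewrite -ltNge => xt; near=> n; rewrite gtr0_sg // subr_gt0 -ltrBrDl.
near: n; have : n.+1%:R^-1 @[n --> \oo] --> (0 : R) by exact: cvg_harmonic.
move/cvgrPdist_lt => /(_ (t - x)); rewrite subr_gt0 => /(_ xt).
by apply: filterS => n; rewrite sub0r normrN gtr0_norm // invr_gt0 ltr0n.
Unshelve. all: by end_near. Qed.

End SignApproximation.

(** * Independence of a real and a finite component from the factorization of characteristic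
    functions *)

Section IndependentComponents.
Context d (Omega : measurableType d) (R : realType) (P : probability Omega R).
Variables (G : finZmodType) (X : {mfun Omega >-> R}) (Y : {mfun Omega >-> discr G}).
(** Later [L] consists of the doubled characters, the only ones at which the factorization is
    established; they still separate points when G has no element of order 2. *)
Variable L : (G -> R) -> Prop.
Hypothesis LD : forall u v, L u -> L v -> L (fun t => u t + v t).
Hypothesis LN : forall u, L u -> L (fun t => - u t).
Hypothesis L0 : L (fun=> 0).
Hypothesis Lsep : forall g g0 : G, g != g0 ->
  exists2 theta, L theta & cis (theta g0 - theta g) != 1.
Hypothesis cf_factor : forall s theta, L theta ->
  cf P (fun w => s * X w + theta (Y w)) =
  cf P (fun w => s * X w) * cf P (fun w => theta (Y w)).

Let Lin (phi : R -> R) := exists s, phi = fun t => s * t.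

Let LinD u v : Lin u -> Lin v -> Lin (fun t => u t + v t).
Proof. by move=> [a ->] [b ->]; exists (a + b); apply: funext => t; ring. Qed.

Let LinN u : Lin u -> Lin (fun t => - u t).
Proof. by move=> [a ->]; exists (- a); apply: funext => t; ring. Qed.

Let Lin0 : Lin (fun=> 0).
Proof. by exists 0; apply: funext => t; ring. Qed.

Lemma measurable_discr d' (T' : measurableType d') (f : discr G -> T') :
  measurable_fun setT f.
Proof. by []. Qed.

Variable B : set (discr G).
Let J w : R := \1_B (Y w).

(** Measurability and the uniform bound are included so that this class is stable under pointwise
    limits, by dominated convergence. *)
Let factors (h : R -> R) := measurable_fun setT h /\ (forall t, `|h t| <= 1) /\
  \int[P]_w (h (X w) * J w) = \int[P]_w h (X w) * \int[P]_w J w.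

Let mJ : measurable_fun setT J.
Proof.
exact: (measurableT_comp (@measurable_discr _ _ (fun g => \1_B g : R)) (measurable_funP Y)).
Qed.

Let J1 w : `|J w| <= 1.
Proof. by rewrite /J indicE; case: (_ \in _); rewrite ?normr1 ?normr0. Qed.

Let factors_lim (h_ : nat -> R -> R) h : (forall n, factors (h_ n)) ->
  (forall t, h_ n t @[n --> \oo] --> h t) -> factors h.
Proof.
move=> fh ch.
have mh : measurable_fun setT h.
  by apply: (measurable_fun_cvg (h := h_)) => [n|t _]; [exact: (fh n).1|exact: ch].
split=> //; split.
  move=> t; apply: (closed_cvg _ (@closed_le _ 1) _ _ (cvg_norm (ch t))).
  by apply: nearW => n; exact: (fh n).2.1.
have mhX n : measurable_fun setT (fun w => h_ n (X w)).
  exact: (measurableT_comp (fh n).1 (measurable_funP X)).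
have l1 : \int[P]_w (h_ n (X w) * J w) @[n --> \oo] --> \int[P]_w (h (X w) * J w).
  apply: (@bounded_cvg_Rintegral _ _ _ P _ _ 1) => [n|n w|w].
  - exact: measurable_funM.
  - by rewrite normrM mulr_ile1 // (fh n).2.1.
  - by apply: cvgMr_tmp; exact: ch.
have l2 : \int[P]_w h_ n (X w) * \int[P]_w J w @[n --> \oo] -->
    \int[P]_w h (X w) * \int[P]_w J w.
  apply: cvgMr_tmp; apply: (@bounded_cvg_Rintegral _ _ _ P _ _ 1) => [n|n w|w].
  - exact: mhX.
  - exact: (fh n).2.1.
  - exact: ch.
have E : (fun n => \int[P]_w (h_ n (X w) * J w)) =
    fun n => \int[P]_w h_ n (X w) * \int[P]_w J w.
  by apply: funext => n; exact: (fh n).2.2.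
by rewrite E in l1; exact: (cvg_unique _ l1 l2).
Qed.

Let factors_ray x : factors (fun t => if t <= x then -1 else 1).
Proof.
apply: (@factors_lim (fun n t => Num.sg (t - (x + n.+1%:R^-1)))) => [n|t]; last first.
  exact: sg_right_cvg.
move: (x + _) => {}x.
apply: (@factors_lim (fun n t => Num.sg (sin ((t - x) / n.+1%:R)))) => [{}n|t]; last first.
  exact: sg_sin_cvg.
move: (n.+1%:R) => k.
pose f t : R := sin ((t - x) / k).
have mf : measurable_fun setT f.
  by apply: (@measurable_sinr _ _ R (fun t : R => (t - x) / k)); apply: measurable_funM => //;
    apply: measurable_funB.
have tf : trigpoly Lin f.
  rewrite (_ : f = fun t => cos (k^-1 * t + (- x / k - pi / 2))).
    by apply: trigpoly_cos; exists k^-1.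
  by apply: funext => t; rewrite addrA cosBpihalf /f; congr sin; ring.
apply: (@factors_lim (fun n t => smooth_sign n (f t))) => [{}n|t]; last first.
  by apply: smooth_sign_cvg; exact: normr_sin_le1.
split; last split.
- elim: n => [|n IH] //=; apply: measurable_funM => //; apply: measurable_funB.
    exact: measurable_funM.
  exact: measurable_funX.
- by move=> t; apply: smooth_sign_le1; exact: normr_sin_le1.
apply: (@trigpoly_factor _ _ _ P _ _ Lin L X Y _ _ _ _
  (fun t => smooth_sign n (f t)) (fun g : G => \1_B g)) => //.
- by move=> phi [s ->]; exact: measurable_funM.
- by move=> psi _; exact: (measurableT_comp (@measurable_discr _ _ _) (measurable_funP Y)).
- by move=> phi psi [s ->] Lpsi; exact: cf_factor.
- exact: trigpoly_smooth_sign.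
- exact: trigpoly_finite.
Qed.

Let Y0 : set Omega := Y @^-1` B.

Let mY0 : measurable Y0.
Proof. by rewrite -[Y0]setTI; exact: (measurable_funP Y). Qed.

Let mXA A : measurable A -> measurable (X @^-1` A).
Proof. by move=> mA; rewrite -[_ @^-1` _]setTI; exact: (measurable_funP X). Qed.

Let Rint_indic A : measurable A -> \int[P]_w (\1_A w : R) = fine (P A).
Proof. by move=> mA; rewrite /Rintegral integral_indic // setIT. Qed.

Let indep_ray x : P (X @^-1` `]x, +oo[ `&` Y0) = (P (X @^-1` `]x, +oo[) * P Y0)%E.
Proof.
have [mh [h1 hE]] := factors_ray x; set h := (fun t => _) in mh h1 hE.
have mhX : measurable_fun setT (fun w => h (X w)).
  exact: (measurableT_comp mh (measurable_funP X)).
have mray : measurable (X @^-1` `]x, +oo[) by exact: mXA.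
have JE w : J w = \1_Y0 w by [].
(* The two-valued limit h is -1 off the ray and 1 on it, so its indicator is (h + 1) / 2. *)
have rayE w : \1_(X @^-1` `]x, +oo[) w = 2^-1 * h (X w) + 2^-1 * 1 :> R.
  rewrite indicE /h; case: ifPn => xw; last first.
    by rewrite mem_set /= ?in_itv /= ?andbT ?ltNge //; field.
  by rewrite memNset /= ?in_itv /= ?andbT; [field|rewrite ltNge xw].
have e1 : \int[P]_w (\1_(X @^-1` `]x, +oo[ `&` Y0) w : R) =
    2^-1 * \int[P]_w (h (X w) * J w) + 2^-1 * \int[P]_w J w.
  rewrite -(@Rintegral_lin2 _ _ _ P (fun w => h (X w) * J w) J _ _ 1 1) //.
  - by apply: eq_Rintegral => w _; rewrite indicI /= rayE -JE; ring.
  - exact: measurable_funM.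
  - by move=> w; rewrite ?normrM ?mulr_ile1 ?h1 ?J1 ?normr_ge0.
have e2 : \int[P]_w (\1_(X @^-1` `]x, +oo[) w : R) = 2^-1 * \int[P]_w h (X w) + 2^-1 * 1.
  rewrite -[X in _ = _ + _ * X](@Rexpectation_cst _ _ _ P).
  rewrite -(@Rintegral_lin2 _ _ _ P (fun w => h (X w)) (fun=> 1) _ _ 1 1) //.
  - by apply: eq_Rintegral => w _; rewrite rayE.
  - by move=> w; exact: h1.
  - by move=> w; rewrite normr1.
have e3 : \int[P]_w J w = \int[P]_w (\1_Y0 w : R).
  by apply: eq_Rintegral => w _; rewrite JE.
have : fine (P (X @^-1` `]x, +oo[ `&` Y0)) = fine (P (X @^-1` `]x, +oo[)) * fine (P Y0).
  rewrite -!Rint_indic //; last exact: measurableI.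
  by rewrite e1 hE e2 e3; ring.
move=> E; rewrite -[LHS]fineK; last by apply: fin_num_measure; exact: measurableI.
by rewrite E EFinM !fineK //; exact: fin_num_measure.
Qed.

(** Both sides are finite measures in A. They agree on the open rays, which generate the Borel sets
    and are stable under intersection. *)
Theorem indep_components A : measurable A ->
  P (X @^-1` A `&` Y @^-1` B) = (P (X @^-1` A) * P (Y @^-1` B))%E.
Proof.
pose m := (pushforward (mrestr P mY0) X : {measure set R -> \bar R}).
pose m1 := m (measurable_funP X).
have r0 : 0 <= fine (P Y0) by exact: fine_ge0.
pose m2 : {measure set R -> \bar R} := mscale (NngNum r0) (distribution P X).
have m2E C : m2 C = (P (X @^-1` C) * P Y0)%E.
  rewrite [RHS]muleC -[X in _ = (X * _)%E]fineK //.
  exact: fin_num_measure.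
move=> mA; rewrite -/Y0 -m2E -[LHS]/(m1 A).
refine (@measure_unique _ R _ (@RGenOInfty.G R) (fun n => `]- n%:R, +oo[%classic)
  _ _ _ _ m1 m2 _ _ A mA) => //.
- exact: RGenOInfty.measurableE.
- move=> _ _ [x ->] [y ->]; exists (Num.max x y).
  by apply/seteqP; split => z /=; rewrite !in_itv /= !andbT gt_max; [move=> [-> ->]|move=> /andP[]].
- by move=> n; exists (- n%:R).
- apply/seteqP; split => // z _; exists (Num.truncn `|z|).+1 => //=.
  rewrite in_itv /= andbT ltrNl (le_lt_trans (ler_norm _)) // normrN.
  by have /andP[] := truncn_itv (normr_ge0 z).
- by move=> _ [x ->]; rewrite m2E -indep_ray.
- move=> n; rewrite -[m1 _]/(P (_ `&` _)) ltey_eq fin_num_measure //.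
  by apply: measurableI => //; exact: mXA.
Qed.

End IndependentComponents.

(** The product sigma-algebra is generated by rectangles, so finiteness is used to write every
    subset as a finite union of singletons. *)
Lemma measurable_discr2 (G1 G2 : finZmodType) d (T : measurableType d)
    (f : discr G1 * discr G2 -> T) : measurable_fun setT f.
Proof.
move=> _ B mB; rewrite setTI.
have -> : f @^-1` B = \bigcup_(z in f @^-1` B) ([set z.1] `*` [set z.2]).
  apply/seteqP; split => [z Bz|[z1 z2] [[y1 y2] By /= [-> ->]]] //.
  by exists z.
apply: fin_bigcup_measurable; first exact: (@finite_finset (G1 * G2)%type).
by move=> z _; apply: measurableX.
Qed.

Section SetFunctionIntegral.
Import HBNNSimple.

(* [convX] is not packaged as a measure: only its values on measurable sets are
   controlled. *)
Lemma eq_set_integral d (T : measurableType d) (R : realType) (m1 m2 : set T -> \bar R)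
    (D : set T) f : (forall A, measurable A -> m1 A = m2 A) ->
  (\int[m1]_(x in D) f x = \int[m2]_(x in D) f x)%E.
Proof.
move=> m12; rewrite /integral.
have E (h : {nnsfun T >-> R}) : sintegral m1 h = sintegral m2 h.
  by apply: eq_fsbigr => r _; rewrite m12.
have H (g : T -> \bar R) : ereal_sup [set sintegral m1 h | h in
    [set h : {nnsfun T >-> R} | forall x, ((h x)%:E <= g x)%E]] =
  ereal_sup [set sintegral m2 h | h in
    [set h : {nnsfun T >-> R} | forall x, ((h x)%:E <= g x)%E]].
  by congr ereal_sup; apply: eq_imagel => h _; exact: E.
by rewrite !H.
Qed.

End SetFunctionIntegral.

(** * Consequences of independence, equality of laws, and atoms of a finite component *)

Section Probability.
Context d (Omega : measurableType d) (R : realType) (P : probability Omega R).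

Lemma cf_indep d1 d2 (T1 : measurableType d1) (T2 : measurableType d2)
    (X : {mfun Omega >-> T1}) (Y : {mfun Omega >-> T2}) (phi : T1 -> R) (psi : T2 -> R) :
  (forall A B, measurable A -> measurable B ->
     P (X @^-1` A `&` Y @^-1` B) = (P (X @^-1` A) * P (Y @^-1` B))%E) ->
  measurable_fun setT phi -> measurable_fun setT psi ->
  cf P (fun w => phi (X w) + psi (Y w)) =
  cf P (fun w => phi (X w)) * cf P (fun w => psi (Y w)).
Proof.
move=> ind mphi mpsi.
have mX : measurable_fun setT (fun w => phi (X w)) by exact: measurableT_comp.
have mY : measurable_fun setT (fun w => psi (Y w)) by exact: measurableT_comp.
have E (f1 f2 : R -> R) : continuous f1 -> continuous f2 -> (forall x, `|f1 x| <= 1) ->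
    (forall x, `|f2 x| <= 1) -> \int[P]_w (f1 (phi (X w)) * f2 (psi (Y w))) =
    \int[P]_w f1 (phi (X w)) * \int[P]_w f2 (psi (Y w)).
  move=> c1 c2 b1 b2; apply: (@Rintegral_indep _ _ _ _ _ _ _ P X Y (f1 \o phi) (f2 \o psi)) => //.
  - by apply: measurableT_comp mphi; exact: continuous_measurable_fun.
  - by apply: measurableT_comp mpsi; exact: continuous_measurable_fun.
  - by move=> x; exact: b1.
  - by move=> x; exact: b2.
have cc := @continuous_cos R; have cs := @continuous_sin R.
have bc := @normr_cos_le1 R; have bs := @normr_sin_le1 R.
have bM (f1 f2 : R -> R) : (forall x, `|f1 x| <= 1) -> (forall x, `|f2 x| <= 1) ->
    forall w, `|f1 (phi (X w)) * f2 (psi (Y w))| <= 1.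
  by move=> b1 b2 w; rewrite normrM mulr_ile1.
have [mcX msX] := (measurable_cosr mX, measurable_sinr mX).
have [mcY msY] := (measurable_cosr mY, measurable_sinr mY).
rewrite /cf.
under eq_Rintegral do rewrite cosD -[cos _ * _]mul1r -mulN1r.
under [X in _ +i* X]eq_Rintegral do rewrite sinD -[X in X + _]mul1r -[X in _ + X]mul1r.
rewrite (@Rintegral_lin2 _ _ _ P _ _ 1 (-1) 1 1); last 4 first.
- exact: measurable_funM.
- exact: measurable_funM.
- by apply: bM.
- by apply: bM.
rewrite (@Rintegral_lin2 _ _ _ P _ _ 1 1 1 1); last 4 first.
- exact: measurable_funM.
- exact: measurable_funM.
- by apply: bM.
- by apply: bM.
rewrite !E //.
by apply/eqP; rewrite eq_complex /=; apply/andP; split; apply/eqP; ring.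
Qed.

Lemma cf_eq_law d1 (T : measurableType d1) (U V : {mfun Omega >-> T}) (f : T -> R) :
  (forall C, measurable C -> P (U @^-1` C) = P (V @^-1` C)) ->
  measurable_fun setT f -> cf P (f \o U) = cf P (f \o V).
Proof.
move=> UV mf.
have E (h : R -> R) : continuous h -> (forall x, `|h x| <= 1) ->
    \int[P]_w h (f (U w)) = \int[P]_w h (f (V w)).
  move=> ch bh; congr fine.
  have mh : measurable_fun setT (h \o f).
    by apply: measurableT_comp mf; exact: continuous_measurable_fun.
  have L (W : {mfun Omega >-> T}) : (\int[P]_w (h (f (W w)))%:E =
      \int[distribution P W]_x (h (f x))%:E)%E.
    rewrite integral_distribution //; first exact/measurable_EFinP.
    apply: (@bounded_integrable _ _ _ P (h \o f \o W) 1); last by move=> w; exact: bh.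
    exact: measurableT_comp.
  rewrite !L; apply: eq_measure_integral => A mA _; exact: UV.
by rewrite /cf; congr (_ +i* _); apply: E; solve [exact: continuous_cos|
  exact: continuous_sin|exact: normr_cos_le1|exact: normr_sin_le1].
Qed.

Lemma ae_eq_measure (A B : set Omega) : measurable A -> measurable B ->
  {ae P, forall w, A w <-> B w} -> P A = P B.
Proof.
move=> mA mB AB; rewrite -[A]setIT -[B]setIT -!integral_indic //.
apply: ae_eq_integral => //; try exact/measurable_EFinP.
apply: filterS AB => w h _; rewrite /= !indicE; congr ((nat_of_bool _)%:R%:E).
by apply/idP/idP; rewrite !inE => /h.
Qed.

Lemma ae_pos_witness (A : set Omega) (Q : Omega -> Prop) :
  (0 < P A)%E -> measurable A -> {ae P, forall w, Q w} -> exists2 w, A w & Q w.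
Proof.
move=> A0 mA [N [mN N0 QN]]; apply: contrapT => h.
have : (P A <= P N)%E.
  apply: le_measure; rewrite ?inE // => w Aw; apply: QN => Qw.
  by apply: h; exists w.
by rewrite N0 leNgt A0.
Qed.

Lemma ae_finite (G : finZmodType) (Y : {mfun Omega >-> discr G}) (Q : G -> Prop) :
  (forall g, (0 < P (Y @^-1` [set g]))%E -> Q g) -> {ae P, forall w, Q (Y w)}.
Proof.
move=> h.
have mY (g : G) : measurable (Y @^-1` [set g]).
  by rewrite -[_ @^-1` _]setTI; exact: (measurable_funP Y).
have H (g : G) : {ae P, forall w, Y w = g -> Q g}.
  have [g0|g0] := ltP 0%E (P (Y @^-1` [set g])); first by apply: nearW => w _; exact: h.
  exists (Y @^-1` [set g]); split=> //; first by apply/eqP; rewrite eq_le g0 measure_ge0.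
  by move=> w /= hw; apply: contrapT => n; apply: hw => /n.
have HG : {ae P, forall w, forall g : G, Y w = g -> Q g} by apply: filter_forall; exact: H.
by apply: filterS HG => w hw; exact: (hw (Y w)).
Qed.

Lemma exists_atom (G : finZmodType) (Y : {mfun Omega >-> discr G}) :
  exists g : G, (0 < P (Y @^-1` [set g]))%E.
Proof.
apply: contrapT => h.
have : {ae P, forall w, False}.
  by apply: (@ae_finite G Y (fun=> False)) => g g0; apply: h; exists g.
have P1 : (0 < P setT)%E by rewrite probability_setT lte01.
by move=> /(ae_pos_witness P1 measurableT)[].
Qed.

End Probability.

(** * Convolutions on R x G *)

Section Convolution.
Variables (R : realType) (G : finZmodType).
Notation X := (XT R G).

Lemma measurable_addX : measurable_fun setT (fun z : X * X => addX z.1 z.2 : X).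
Proof.
apply: measurable_fun_pair.
  apply: measurable_funD; exact: (measurableT_comp measurable_fst).
have h := @measurable_discr2 G G _ _ (fun z => z.1 + z.2 : discr G).
have h2 : measurable_fun setT (fun z : X * X => (z.1.2, z.2.2) : discr G * discr G).
  by apply: measurable_fun_pair; exact: (measurableT_comp measurable_snd).
exact: (measurableT_comp h h2).
Qed.

Lemma measurable_addXr (x0 : X) : measurable_fun setT (fun x : X => addX x x0 : X).
Proof.
have h : measurable_fun setT (fun x : X => (x, x0)) by exact: measurable_fun_pair.
exact: (measurableT_comp measurable_addX h).
Qed.

Lemma convX_dirac (nu : set X -> \bar R) (m : {measure set X -> \bar R}) (x0 : X) A :
  (forall B, measurable B -> nu B = m B) -> measurable A ->
  convX nu (\d_x0) A = m [set x | A (addX x x0)].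
Proof.
move=> nuE mA; rewrite /convX (eq_set_integral _ _ nuE).
have mA' : measurable [set x | A (addX x x0)].
  by rewrite -[X in measurable X]setTI; exact: measurable_addXr.
rewrite -[X in _ = m X]setIT -integral_indic //; apply: eq_integral => x _.
Qed.

(** [omega] lives on {0} x G with G-part [lam], and (t, 0) + (0, g) = (t, g), so the convolution is
    a product measure. *)
Lemma convX_embR (gam : probability R R) (lam : probability (discr G) R)
    (omega : probability X R) B :
  (forall C, measurable C -> omega C = lam [set g | C (0, g)]) -> measurable B ->
  convX (embR gam) omega B = (gam \x lam)%E B.
Proof.
move=> om mB; rewrite /convX.
pose e t : X := (t, 0).
have me : measurable_fun setT e by exact: pair2_measurable.
pose B' := [set z : X * X | B (addX z.1 z.2)].
have mB' : measurable B' by rewrite -[B']setTI; exact: measurable_addX.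
have fE : (fun x => omega [set y | B (addX x y)]) = omega \o xsection B'.
  apply: funext => x /=; congr (omega _).
  by apply/seteqP; split => y; rewrite /xsection /= inE.
rewrite -[embR gam]/(pushforward gam e) ge0_integral_pushforward //; last first.
  by rewrite fE; exact: measurable_fun_xsection.
apply: eq_integral => t _ /=; rewrite om.
  congr (lam _); apply/seteqP; split => g; rewrite /xsection /= inE /addX /= addr0 add0r //.
rewrite [X in measurable X](_ : _ = xsection B' (e t)); first exact: measurable_xsection.
by apply/seteqP; split => y; rewrite /xsection /= inE.
Qed.

Lemma law_eq_convX d (Omega : measurableType d) (P : probability Omega R)
    (xi : {mfun Omega >-> X}) (X1 : {mfun Omega >-> R}) (Y : {mfun Omega >-> discr G})
    (lam : probability (discr G) R) (omega : probability X R) (g0 : G) A :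
  (forall w, xi w = (X1 w, Y w)) ->
  (forall A B, measurable A -> measurable B ->
     P (X1 @^-1` A `&` Y @^-1` B) = (P (X1 @^-1` A) * P (Y @^-1` B))%E) ->
  (forall C, measurable C -> omega C = lam [set g | C (0, g)]) ->
  (forall B, P (Y @^-1` B) = lam [set g | B (g + g0)]) -> measurable A ->
  distribution P xi A = convX (convX (embR (distribution P X1)) omega) (\d_((0, g0) : X)) A.
Proof.
move=> xiE ind om YE mA.
pose m : {measure set X -> \bar R} := ((distribution P X1 : probability R R) \x lam)%E.
have law B : measurable B -> (distribution P X1 \x distribution P Y)%E B = distribution P xi B.
  apply: (@product_measure_unique _ _ _ _ _ (distribution P X1) (distribution P Y)).
  move=> C D mC mD; rewrite -ind //; congr (P _).
  by apply/seteqP; split => w /=; rewrite xiE.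
have nuE B : measurable B -> convX (embR (distribution P X1)) omega B = m B.
  by move=> mB; exact: convX_embR.
rewrite (convX_dirac _ nuE mA) -law //.
apply: eq_integral => t _ /=; rewrite -[LHS]/(P (Y @^-1` (xsection A t))) YE; congr (lam _).
by apply/seteqP; split => g; rewrite /xsection /= !inE /addX /= addr0.
Qed.

End Convolution.

Definition mfun_of d1 d2 (T1 : measurableType d1) (T2 : measurableType d2) (f : T1 -> T2)
    (mf : measurable_fun setT f) : {mfun T1 >-> T2} :=
  HB.pack f (isMeasurableFun.Build _ _ _ _ _ mf).

Lemma measurable_discr_comp (G : finZmodType) d d' (T : measurableType d)
    (T' : measurableType d') (f : G -> T') (h : T -> discr G) :
  measurable_fun setT h -> measurable_fun setT (fun t => f (h t)).
Proof.
move=> mh _ B mB.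
rewrite (_ : (fun t => f (h t)) @^-1` B = h @^-1` [set g | B (f g)]) //.
exact: mh.
Qed.

(** * Arguments of characters of G and of R x G *)

Section CharacterArguments.
Variables (R : realType) (G : finZmodType).
Implicit Types theta tau : G -> R.

Lemma character_argD theta tau : is_character_arg theta -> is_character_arg tau ->
  is_character_arg (fun g => theta g + tau g).
Proof.
move=> h1 h2 x y; have [k ->] := h1 x y; have [l ->] := h2 x y.
by exists (k + l); rewrite intrD; ring.
Qed.

Lemma character_argN theta : is_character_arg theta -> is_character_arg (fun g => - theta g).
Proof.
by move=> h x y; have [k ->] := h x y; exists (- k); rewrite mulrNz; ring.
Qed.

Lemma character_arg_comp theta (f : G -> G) : (forall g h, f (g + h) = f g + f h) ->
  is_character_arg theta -> is_character_arg (fun g => theta (f g)).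
Proof. by move=> fD h x y; rewrite fD; exact: h. Qed.

Lemma character_arg0 : is_character_arg ((fun=> 0) : G -> R).
Proof. by move=> x y; exists 0; rewrite mul0r !addr0. Qed.

Lemma character_cisN theta : is_character_arg theta ->
  forall g, cis (theta (- g)) = conjc (cis (theta g)).
Proof.
move=> h g; apply: (mulfI (cis_neq0 (theta g))).
by rewrite -character_cisD // subrr character_cis0 // cis_conj.
Qed.

Lemma character_inj (x y : G) :
  (forall theta, is_character_arg theta -> cis (theta x) = cis (theta y)) -> x = y.
Proof.
move=> h; apply/eqP; rewrite -subr_eq0; apply/eqP; apply: contrapT => /eqP.
move=> /(@character_separation R)[theta th]; rewrite character_cisD // character_cisN //.
by rewrite h // cis_conj eqxx.
Qed.

Definition character_arg_X (phi : XT R G -> R) :=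
  exists s theta, is_character_arg theta /\ phi = fun x => s * x.1 + theta x.2.

Lemma measurable_character_arg_X u : character_arg_X u -> measurable_fun setT u.
Proof.
move=> [s [th [_ ->]]]; apply: measurable_funD; first exact: measurable_funM.
exact: (measurable_discr_comp th measurable_snd).
Qed.

Lemma character_arg_X_cisD u : character_arg_X u ->
  forall x y, cis (u (addX x y)) = cis (u x) * cis (u y).
Proof.
move=> [s [th [hth ->]]] x y /=.
rewrite mulrDr !cisD character_cisD //; ring.
Qed.

Lemma character_arg_X_cisN u : character_arg_X u ->
  forall x, cis (u (oppX x)) = cis (- u x).
Proof.
move=> [s [th [hth ->]]] x /=.
by rewrite mulrN opprD !cisD character_cisN // -cisN.
Qed.

End CharacterArguments.

(** * The Heyde theorem on R x G *)

Section HeydeOnX.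
Context (R : realType) (G : finZmodType) (hG : forall g : G, g + g = 0 -> g = 0)
  (a : R) (aG : G -> G) (ha : a != 0)
  (aG_add : forall g h : G, aG (g + h) = aG g + aG h) (aG_bij : bijective aG)
  (d : measure_display) (Omega : measurableType d) (P : probability Omega R)
  (xi1 xi2 : {mfun Omega >-> XT R G}).
Hypothesis hind : forall A B : set (XT R G), measurable A -> measurable B ->
  P (xi1 @^-1` A `&` xi2 @^-1` B) = (P (xi1 @^-1` A) * P (xi2 @^-1` B))%E.
Hypothesis hnz1 : forall (s : R) (theta : G -> R), is_character_arg theta ->
  charfun_re (distribution P xi1) s theta <> 0%E \/
  charfun_im (distribution P xi1) s theta <> 0%E.
Hypothesis hnz2 : forall (s : R) (theta : G -> R), is_character_arg theta ->
  charfun_re (distribution P xi2) s theta <> 0%E \/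
  charfun_im (distribution P xi2) s theta <> 0%E.
Let alpha (x : XT R G) : XT R G := ((a * x.1)%R, aG x.2).
Let L1 w : XT R G := addX (xi1 w) (xi2 w).
Let L2 w : XT R G := addX (xi1 w) (alpha (xi2 w)).
Hypothesis hsym : forall C : set (XT R G * XT R G), measurable C ->
  P ((fun w => (L1 w, L2 w)) @^-1` C) = P ((fun w => (L1 w, oppX (L2 w))) @^-1` C).

Let S := @character_arg_X R G.
Let F1 phi := cf P (fun w => phi (xi1 w)).
Let F2 phi := cf P (fun w => phi (xi2 w)).

Let Sal u : S u -> S (fun x => u (alpha x)).
Proof.
move=> [s [th [hth ->]]]; exists (s * a), (fun g => th (aG g)).
by split; [exact: character_arg_comp|apply: funext => x /=; ring].
Qed.

Let mxi (xi : {mfun Omega >-> XT R G}) u : S u -> measurable_fun setT (fun w => u (xi w)).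
Proof.
by move=> /measurable_character_arg_X mu; exact: (measurableT_comp mu (measurable_funP xi)).
Qed.

Lemma charfun_cf (xi : {mfun Omega >-> XT R G}) s theta : is_character_arg theta ->
  let F := cf P (fun w => s * (xi w).1 + theta (xi w).2) in
  charfun_re (distribution P xi) s theta = (complex.Re F)%:E /\
  charfun_im (distribution P xi) s theta = (complex.Im F)%:E.
Proof.
move=> th; have Su : S (fun x => s * x.1 + theta x.2) by exists s, theta.
have mu := measurable_character_arg_X Su; have mw := mxi xi Su.
split; rewrite /charfun_re /charfun_im integral_distribution /=.
- by rewrite fineK //; apply: integrable_fin_num => //; exact: integrable_cos.
- by apply/measurable_EFinP; exact: (measurable_cosr (Z := fun x : XT R G => s * x.1 + theta x.2)).
- exact: integrable_cos.
- by rewrite fineK //; apply: integrable_fin_num => //; exact: integrable_sin.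
- by apply/measurable_EFinP; exact: (measurable_sinr (Z := fun x : XT R G => s * x.1 + theta x.2)).
- exact: integrable_sin.
Qed.

Let F1_neq0 u : S u -> F1 u != 0.
Proof.
move=> [s [th [hth ->]]]; have [h1 h2] := charfun_cf xi1 s hth.
by apply/eqP; rewrite /F1 => h; have := hnz1 s hth; rewrite h1 h2 h /=; case.
Qed.

Let F2_neq0 u : S u -> F2 u != 0.
Proof.
move=> [s [th [hth ->]]]; have [h1 h2] := charfun_cf xi2 s hth.
by apply/eqP; rewrite /F2 => h; have := hnz2 s hth; rewrite h1 h2 h /=; case.
Qed.

Let malpha : measurable_fun setT (alpha : XT R G -> XT R G).
Proof.
apply: measurable_fun_pair; first exact: measurable_funM.
exact: (measurable_discr_comp (aG : G -> discr G) measurable_snd).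
Qed.

Let moppX : measurable_fun setT (@oppX R G : XT R G -> XT R G).
Proof.
apply: measurable_fun_pair; first exact: measurable_funN.
exact: (measurable_discr_comp (-%R : G -> discr G) measurable_snd).
Qed.

Let mL1 : measurable_fun setT L1.
Proof.
have h : measurable_fun setT (fun w => (xi1 w, xi2 w)) by exact: measurable_fun_pair.
exact: (measurableT_comp (@measurable_addX R G) h).
Qed.

Let mL2 : measurable_fun setT L2.
Proof.
have h : measurable_fun setT (fun w => (xi1 w, alpha (xi2 w))).
  by apply: measurable_fun_pair => //; exact: (measurableT_comp malpha).
exact: (measurableT_comp (@measurable_addX R G) h).
Qed.

Let mL12 : measurable_fun setT (fun w => (L1 w, L2 w)).
Proof. exact: measurable_fun_pair. Qed.

Let mL12' : measurable_fun setT (fun w => (L1 w, oppX (L2 w))).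
Proof. by apply: measurable_fun_pair => //; exact: (measurableT_comp moppX). Qed.

(** Independence merges each side into one expectation. Modulo 2 pi its argument is u (L1) + v (L2)
    on the left and u (L1) + v (- L2) on the right, and the symmetry hypothesis equates the two. *)
Let heyde u v : S u -> S v ->
  F1 (fun x => u x + v x) * F2 (fun x => u x + v (alpha x)) =
  F1 (fun x => u x - v x) * F2 (fun x => u x - v (alpha x)).
Proof.
move=> Su Sv; have Sva := Sal Sv.
have [mu mv mva] := And3 (measurable_character_arg_X Su) (measurable_character_arg_X Sv)
  (measurable_character_arg_X Sva).
rewrite /F1 /F2 -(cf_indep (phi := fun x => u x + v x) (psi := fun x => u x + v (alpha x)) hind);
  [|exact: measurable_funD|exact: measurable_funD].
rewrite -(cf_indep (phi := fun x => u x - v x) (psi := fun x => u x - v (alpha x)) hind);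
  [|exact: measurable_funB|exact: measurable_funB].
rewrite (@cf_eq _ _ _ _ _ (fun w => u (L1 w) + v (L2 w))); last first.
  by move=> w; rewrite !cisD !character_arg_X_cisD //; ring.
rewrite [RHS](@cf_eq _ _ _ _ _ (fun w => u (L1 w) + v (oppX (L2 w)))); last first.
  move=> w; rewrite !cisD character_arg_X_cisN // !cisN !character_arg_X_cisD // conjcM.
  by ring.
apply: (@cf_eq_law _ _ _ P _ _ (mfun_of mL12) (mfun_of mL12')
  (fun z : XT R G * XT R G => u z.1 + v z.2)) => //.
by apply: measurable_funD; [exact: (measurableT_comp mu)|exact: (measurableT_comp mv)].
Qed.

(** Characters that are trivial on R: on them the moduli have period #|G|, as [heyde_modulus_eq1]
    requires. *)
Let S0 (phi : XT R G -> R) :=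
  exists theta : G -> R, is_character_arg theta /\ phi = fun x => theta x.2.

Let S0S u : S0 u -> S u.
Proof. by move=> [th [hth ->]]; exists 0, th; split=> //; apply: funext => x; ring. Qed.

Let nrm2 (z : R[i]) := complex.Re z ^+ 2 + complex.Im z ^+ 2.

Let nrm2M z1 z2 : nrm2 (z1 * z2) = nrm2 z1 * nrm2 z2.
Proof. by case: z1 z2 => [x1 y1] [x2 y2]; rewrite /nrm2 /=; ring. Qed.

Let nrm2_gt0 z : z != 0 -> 0 < nrm2 z.
Proof.
case: z => x y; rewrite eq_complex /= negb_and /nrm2 /= => h.
rewrite lt0r addr_ge0 ?sqr_ge0 // andbT paddr_eq0 ?sqr_ge0 // !sqrf_eq0 negb_and.
exact: h.
Qed.

Let cf_per (xi : {mfun Omega >-> XT R G}) u v : S0 v ->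
  cf P (fun w => u (xi w) + v (xi w) *+ #|G|.-1.+1) = cf P (fun w => u (xi w)).
Proof.
move=> [th [hth ->]]; apply: cf_eq => w; rewrite cisD prednK; last first.
  by apply/card_gt0P; exists 0.
by rewrite character_cis_order // mulr1.
Qed.

Let cfN2 (xi : {mfun Omega >-> XT R G}) u : S u ->
  nrm2 (cf P (fun w => - u (xi w))) = nrm2 (cf P (fun w => u (xi w))).
Proof.
move=> Su; rewrite cfN; last exact: mxi.
by case: (cf P _) => x y; rewrite /nrm2 /= sqrrN.
Qed.

Let cf_nrm2_0 (xi : {mfun Omega >-> XT R G}) : nrm2 (cf P (fun w => 0)) = 1.
Proof. by rewrite cf0 /nrm2 /= expr1n expr0n /= addr0. Qed.

(* For fixed theta, W g = theta (aG (x + x)) mod 2 pi with x = g + aG g. *)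
Lemma modulus_eq1 theta : is_character_arg theta ->
  let W (g : G) := (theta (aG g) + theta (aG (aG g))) *+ 2 in
  nrm2 (cf P (fun w => W (xi1 w).2)) = 1 /\ nrm2 (cf P (fun w => W (xi2 w).2)) = 1.
Proof.
move=> hth W.
apply: (@heyde_modulus_eq1 (XT R G) R R alpha S0 (fun u => nrm2 (F1 u)) (fun u => nrm2 (F2 u))
  _ _ _ _ _ _ _ _ _ _ _ _ #|G|.-1 _ _ (fun x => theta x.2)).
- move=> u v [th [h1 ->]] [ta [h2 ->]]; exists (fun g => th g + ta g).
  by split=> //; exact: character_argD.
- by move=> u [th [h1 ->]]; exists (fun g => - th g); split=> //; exact: character_argN.
- move=> u [th [h1 ->]]; exists (fun g => th (aG g)).
  by split=> //; exact: character_arg_comp.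
- by move=> u v /S0S Su /S0S Sv; rewrite -!nrm2M heyde.
- by move=> u /S0S Su; apply: nrm2_gt0; exact: F1_neq0.
- by move=> u /S0S Su; apply: nrm2_gt0; exact: F2_neq0.
- by move=> u /S0S Su; apply: cf_le1; exact: mxi.
- by move=> u /S0S Su; apply: cf_le1; exact: mxi.
- by move=> u /S0S Su; exact: cfN2.
- by move=> u /S0S Su; exact: cfN2.
- exact: cf_nrm2_0.
- exact: cf_nrm2_0.
- by move=> u v Su Sv; rewrite /F1 cf_per.
- by move=> u v Su Sv; rewrite /F2 cf_per.
- by exists theta.
Qed.

Let msnd (xi : {mfun Omega >-> XT R G}) : measurable_fun setT (fun w => (xi w).2).
Proof. exact: (measurableT_comp measurable_snd (measurable_funP xi)). Qed.

Let mfst (xi : {mfun Omega >-> XT R G}) : measurable_fun setT (fun w => (xi w).1).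
Proof. exact: (measurableT_comp measurable_fst (measurable_funP xi)). Qed.

(** A characteristic function of modulus 1 at theta makes theta (k (xi.2)) almost surely constant
    modulo 2 pi, so every theta takes the same value at k of any two atoms. Characters separate
    points, and injectivity of doubling and of [aG] recovers g + aG g from k g. *)
Lemma ae_kernel_coset (xi : {mfun Omega >-> XT R G}) g :
  (forall theta : G -> R, is_character_arg theta ->
    nrm2 (cf P (fun w => (theta (aG (xi w).2) + theta (aG (aG (xi w).2))) *+ 2)) = 1) ->
  (0 < P ((fun w => (xi w).2) @^-1` [set g]))%E ->
  {ae P, forall w, (xi w).2 + aG (xi w).2 = g + aG g}.
Proof.
move=> uni g0.
apply: (@ae_finite _ _ _ P G (mfun_of (msnd xi)) (fun g' => g' + aG g' = g + aG g)) => g' g'0.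
have mA (h : G) : measurable ((fun w => (xi w).2) @^-1` [set h]).
  by rewrite -[_ @^-1` _]setTI; exact: msnd.
pose k (h : G) := aG (h + aG h) + aG (h + aG h).
suff : k g' = k g.
  move=> /eqP; rewrite -subr_eq0 opprD addrACA => /eqP /hG /eqP.
  by rewrite subr_eq0 => /eqP /(bij_inj aG_bij).
apply: (@character_inj R) => theta hth.
pose W (h : G) := (theta (aG h) + theta (aG (aG h))) *+ 2.
have WE h : cis (W h) = cis (theta (k h)).
  by rewrite /W /k cisMn cisD character_cisD // aG_add character_cisD // expr2.
have mW : measurable_fun setT (fun w => W (xi w).2) by exact: (measurable_discr_comp W (msnd xi)).
have ae := cf_unimodular mW (uni theta hth).
have [w e h] := ae_pos_witness g0 (mA g) ae.
have [w' e' h'] := ae_pos_witness g'0 (mA g') ae.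
by rewrite -!WE -e -e' /= h h'.
Qed.

Let half_exists : exists h : G -> G, forall g, h (g + g) = g.
Proof.
have inj : injective (fun g : G => g + g).
  move=> x y /eqP; rewrite -subr_eq0 opprD addrACA => /eqP /hG /eqP.
  by rewrite subr_eq0 => /eqP.
by exists (invF inj) => g; exact: (invF_f inj).
Qed.

(* As [alpha_G xi_2 = kappa - xi_2], the map D below sends (L_1, L_2) to xi_2 and
   (L_1, - L_2) to xi_1 + kappa on the G-component, and for [a = -1] also on R. *)
Lemma law_shift kappa A : {ae P, forall w, (xi2 w).2 + aG (xi2 w).2 = kappa} -> measurable A ->
  P [set w | A ((1 - a) / 2 * (xi2 w).1, (xi2 w).2)] =
  P [set w | A ((xi1 w).1 + (1 + a) / 2 * (xi2 w).1, (xi1 w).2 + kappa)].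
Proof.
move=> hk mA; have [half halfE] := half_exists.
(* Halves of L_1 - L_2, the G-part being first translated by kappa. On R, 2 xi_1 + (1 + a) xi_2
   replaces (1 - a) xi_2 when L_2 changes sign; on G, doubles of xi_1 + kappa and of xi_2 are
   exchanged. *)
pose D (z : XT R G * XT R G) : XT R G :=
  ((z.1.1 - z.2.1) / 2, half (z.1.2 - z.2.2 + kappa)).
have mD : measurable_fun setT D.
  apply: measurable_fun_pair.
    apply: measurable_funM => //; apply: measurable_funB.
      exact: (measurableT_comp measurable_fst measurable_fst).
    exact: (measurableT_comp measurable_fst measurable_snd).
  have h2 : measurable_fun setT (fun z : XT R G * XT R G => (z.1.2, z.2.2) : discr G * discr G).
    by apply: measurable_fun_pair; exact: (measurableT_comp measurable_snd).
  exact: (measurableT_comp (@measurable_discr2 G G _ _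
    (fun z => half (z.1 - z.2 + kappa) : discr G)) h2).
have mDA : measurable (D @^-1` A) by rewrite -[_ @^-1` _]setTI; exact: mD.
have mpre (f : Omega -> XT R G) : measurable_fun setT f -> measurable [set w | A (f w)].
  by move=> mf; rewrite -[X in measurable X]setTI; exact: mf.
have sym := hsym mDA.
have iffE x y : x = y -> (A x <-> A y) by move=> ->.
transitivity (P ((fun w => (L1 w, L2 w)) @^-1` (D @^-1` A))).
  apply: ae_eq_measure.
  - apply: (mpre (fun w => _)); apply: measurable_fun_pair => //.
    by apply: measurable_funM => //.
  - exact: (mpre (fun w => D (L1 w, L2 w)) (measurableT_comp mD mL12)).
  - apply: filterS hk => w hw.
    apply: (iffE (_, _) (D (L1 w, L2 w))).
    rewrite /D /L1 /L2 /=; congr pair; first by field.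
    have Z (x y z : G) : x + y - (x + z) + (y + z) = y + y.
      by rewrite opprD (addrACA x y) subrr add0r addrACA addNr addr0.
    by rewrite -hw Z halfE.
rewrite sym; apply: ae_eq_measure.
- exact: (mpre (fun w => D (L1 w, oppX (L2 w))) (measurableT_comp mD mL12')).
- apply: (mpre (fun w => _)); apply: measurable_fun_pair => //.
    by apply: measurable_funD => //; apply: measurable_funM => //.
  exact: (measurable_discr_comp (fun g => g + kappa : discr G) (msnd xi1)).
- apply: filterS hk => w hw.
  apply: (iffE (D (L1 w, oppX (L2 w))) (_, _)).
  rewrite /D /L1 /L2 /=; congr pair; first by field.
  have Z (x y z : G) : x + y + (x + z) + (y + z) = (x + (y + z)) + (x + (y + z)).
    by rewrite (addrACA x y) -[LHS]addrA [RHS]addrACA.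
  by rewrite opprK -hw Z halfE.
Qed.

(** * The case a <> -1: independent components and Gaussian real parts *)

Section NonSpecialSlope.
Hypothesis aN1 : a != -1.
Variable kappa : G.
Hypothesis ae_kappa : {ae P, forall w, (xi2 w).2 + aG (xi2 w).2 = kappa}.

Let B1 s := cf P (fun w => s * (xi1 w).1).
Let B2 s := cf P (fun w => s * (xi2 w).1).

Let Slin s : S (fun x => s * x.1).
Proof.
by exists s, (fun=> 0); split; [exact: character_arg0|apply: funext => x; ring].
Qed.

Let B1_neq0 s : B1 s != 0.
Proof. exact: (F1_neq0 (Slin s)). Qed.

Let B2_neq0 s : B2 s != 0.
Proof. exact: (F2_neq0 (Slin s)). Qed.

Let heyde_lin u v : B1 (u + v) * B2 (u + a * v) = B1 (u - v) * B2 (u - a * v).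
Proof.
have := heyde (Slin u) (Slin v); rewrite /F1 /F2 /B1 /B2 /=.
rewrite (_ : (fun w => u * (xi1 w).1 + v * (xi1 w).1) = fun w => (u + v) * (xi1 w).1);
  last by apply: funext => w; ring.
rewrite (_ : (fun w => u * (xi1 w).1 - v * (xi1 w).1) = fun w => (u - v) * (xi1 w).1);
  last by apply: funext => w; ring.
rewrite (_ : (fun w => u * (xi2 w).1 + v * _) = fun w => (u + a * v) * (xi2 w).1);
  last by apply: funext => w; ring.
by rewrite (_ : (fun w => u * (xi2 w).1 - v * _) = fun w => (u - a * v) * (xi2 w).1);
  last by apply: funext => w; ring.
Qed.

Let B1_0 : B1 0 = 1.
Proof. by rewrite /B1 -(cf0 P); apply: cf_eq => w; rewrite mul0r. Qed.

Let B2_0 : B2 0 = 1.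
Proof. by rewrite /B2 -(cf0 P); apply: cf_eq => w; rewrite mul0r. Qed.

(* Since [a <> -1], the pair [(s + t, s - a t)] takes all values, and the equation
   at [((s, theta), (t, theta))] separates the two variables. *)
Lemma cf_factorization theta s : is_character_arg theta ->
  let th2 g := theta g + theta g in
  F1 (fun x => s * x.1 + th2 x.2) = B1 s * F1 (fun x => th2 x.2) /\
  F2 (fun x => s * x.1 + th2 x.2) = B2 s * F2 (fun x => th2 x.2).
Proof.
move=> hth th2; have a1 : 1 + a != 0 by rewrite addrC -[1]opprK subr_eq0.
pose A1 x := F1 (fun p => x * p.1 + th2 p.2).
pose A2 x := F2 (fun p => x * p.1 + th2 p.2).
pose c := cis (theta kappa); have c0 : c != 0 by exact: cis_neq0.
have Sth x : S (fun p => x * p.1 + theta p.2) by exists x, theta.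
have Stha x : S (fun p => x * p.1 + theta (aG p.2)).
  by exists x, (fun g => theta (aG g)); split=> //; exact: character_arg_comp.
have ckappa : {ae P, forall w, cis (theta (xi2 w).2) * cis (theta (aG (xi2 w).2)) = c}.
  by apply: filterS ae_kappa => w hw; rewrite -character_cisD // hw.
(* Almost surely theta (aG xi_2) = theta (kappa) - theta (xi_2) modulo 2 pi. So theta + theta o aG
   contributes the constant [c], and theta - theta o aG is 2 theta up to that constant. The real
   equation [e0] at the same (u, t) eliminates [z] and [v]. *)
have key x y : A1 x * B2 y * c ^+ 2 = A2 y * B1 x.
  pose t := (x - y) / (1 + a); pose u := x - t.
  have ex : x = u + t by rewrite /u subrK.
  have ey : y = u - a * t by rewrite /u /t; field.
  pose z := u + a * t; pose v := u - t.
  have e0 : B1 x * B2 z = B1 v * B2 y by rewrite ex ey heyde_lin.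
  have := heyde (Sth u) (Sth t).
  rewrite (_ : (fun p => _ + _ + _) = fun p => x * p.1 + th2 p.2); last first.
    by apply: funext => p; rewrite /th2 ex; ring.
  rewrite -/(A1 x).
  rewrite (_ : F1 (fun p => _ - _) = B1 v); last first.
    by rewrite /F1 /B1; congr cf; apply: funext => w; rewrite /v; ring.
  rewrite (_ : F2 (fun p => _ + _) = B2 z * c); last first.
    apply: ae_cf_shift; first exact: mxi (Slin z).
      by apply: measurable_funD; [exact: mxi (Sth u)|exact: mxi (Sal (Sth t))].
    apply: filterS ckappa => w <-.
    by rewrite -!cisD /z /=; congr cis; ring.
  set F2v := F2 _ => e1.
  have e2 : A2 y = F2v * c.
    apply: ae_cf_shift.
    - by apply: measurable_funB; [exact: mxi (Sth u)|exact: mxi (Sal (Sth t))].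
    - apply: measurable_funD; first exact: mxi (Slin y).
      exact: (measurable_discr_comp th2 (msnd xi2)).
    apply: filterS ckappa => w <-.
    by rewrite -!cisD /th2 ey /=; congr cis; ring.
  apply: (mulfI (B2_neq0 z)).
  transitivity (A1 x * (B2 z * c) * B2 y * c); first by ring.
  rewrite e1; transitivity (B1 v * B2 y * (F2v * c)); first by ring.
  by rewrite -e0 -e2; ring.
have A10 : A1 0 = F1 (fun x => th2 x.2).
  by rewrite /A1; congr F1; apply: funext => x; ring.
have A20 : A2 0 = F2 (fun x => th2 x.2).
  by rewrite /A2; congr F2; apply: funext => x; ring.
have k0s y : A1 0 * B2 y * c ^+ 2 = A2 y by rewrite key B1_0 mulr1.
have ks0 x : A1 x * c ^+ 2 = A2 0 * B1 x by rewrite -key B2_0 mulr1.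
have c20 : c ^+ 2 != 0 by rewrite expf_neq0.
have k00 : A1 0 * c ^+ 2 = A2 0 by rewrite ks0 B1_0 mulr1.
rewrite -/(A1 s) -/(A2 s) -A10 -A20; split.
- by apply: (mulIf c20); rewrite ks0 -k00; ring.
- by rewrite -k0s -k00; ring.
Qed.

Lemma independent_components (xi : {mfun Omega >-> XT R G}) :
  (forall theta s, is_character_arg theta ->
    let th2 (g : G) := theta g + theta g in
    cf P (fun w => s * (xi w).1 + th2 (xi w).2) =
    cf P (fun w => s * (xi w).1) * cf P (fun w => th2 (xi w).2)) ->
  forall A B, measurable A -> measurable B ->
    P (mfun_of (mfst xi) @^-1` A `&` mfun_of (msnd xi) @^-1` B) =
    (P (mfun_of (mfst xi) @^-1` A) * P (mfun_of (msnd xi) @^-1` B))%E.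
Proof.
move=> fac A B mA mB.
apply: (@indep_components _ _ R P G _ _ (fun phi => exists theta, is_character_arg theta /\
  phi = fun g => theta g + theta g)) => //.
- move=> u v [th [h1 ->]] [ta [h2 ->]]; exists (fun g => th g + ta g).
  by split; [exact: character_argD|apply: funext => g; ring].
- move=> u [th [h1 ->]]; exists (fun g => - th g).
  by split; [exact: character_argN|apply: funext => g; ring].
- by exists (fun=> 0); split; [exact: character_arg0|apply: funext => g; ring].
- move=> g g0 gg0.
  have : (g0 - g) + (g0 - g) != 0.
    by apply: contra_neq gg0 => /hG /eqP; rewrite subr_eq0 => /eqP.
  move=> /(@character_separation R)[theta hth h1].
  exists (fun g => theta g + theta g); first by exists theta.
  apply: contra_neq h1 => <-.
  (* The doubled character at the pair (g0, g) is theta at twice g0 - g. *)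
  rewrite character_cisD // character_cisD // character_cisN // opprD !cisD !cisN; ring.
- by move=> s th [theta [hth ->]]; exact: fac.
Qed.

(** Modulus 1 at y makes e^{iyZ} almost surely constant, so it leaves the expectation. This supplies
    [F1_unimodular] in the case a = 1. *)
Lemma cf_unimodular_morphism (Z : Omega -> R) : measurable_fun setT Z ->
  (forall s, nrm2 (cf P (fun w => s * Z w)) = 1) ->
  forall x y, cf P (fun w => (x + y) * Z w) = cf P (fun w => x * Z w) * cf P (fun w => y * Z w).
Proof.
move=> mZ uni x y.
have ms s : measurable_fun setT (fun w => s * Z w) by exact: measurable_funM.
apply: ae_cf_shift => //.
apply: filterS (cf_unimodular (ms y) (uni y)) => w <-.
by rewrite mulrDl cisD.
Qed.

Lemma gaussian_distribution (X1 : {mfun Omega >-> R}) sigma b : 0 <= sigma ->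
  gaussian_cf (fun s => cf P (fun w => s * X1 w)) sigma b -> gaussian (distribution P X1).
Proof.
move=> s0 h; exists sigma, b; split=> // s.
have mf : measurable_fun setT (fun w => s * X1 w) by exact: measurable_funM.
have ms : measurable_fun setT (fun t : R => s * t) by exact: measurable_funM.
have := h s; rewrite /cf /cis => /eqP; rewrite eq_complex /= => /andP[/eqP hc /eqP hs].
split.
- rewrite integral_distribution /=; last exact: integrable_cos.
    rewrite -[LHS]fineK; last by apply: integrable_fin_num => //; exact: integrable_cos.
    by congr (_%:E); rewrite -[LHS]/(\int[P]_w cos (s * X1 w)) hc; ring.
  by apply/measurable_EFinP; exact: (measurable_cosr ms).
- rewrite integral_distribution /=; last exact: integrable_sin.
    rewrite -[LHS]fineK; last by apply: integrable_fin_num => //; exact: integrable_sin.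
    by congr (_%:E); rewrite -[LHS]/(\int[P]_w sin (s * X1 w)) hs; ring.
  by apply/measurable_EFinP; exact: (measurable_sinr ms).
Qed.

Lemma gaussian_marginals :
  gaussian (distribution P (mfun_of (mfst xi1))) /\
  gaussian (distribution P (mfun_of (mfst xi2))).
Proof.
have [s1 [b1 [s2 [b2 [h1 h2 g1 g2]]]]] : exists s1 b1 s2 b2,
    [/\ 0 <= s1, 0 <= s2, gaussian_cf B1 s1 b1 & gaussian_cf B2 s2 b2].
  apply: (heyde_gaussian ha aN1 heyde_lin) => //.
  - move=> s; rewrite /B1 -cfN; last exact: (mxi xi1 (Slin s)).
    by apply: cf_eq => w; rewrite mulNr.
  - by move=> s; apply: cf_le1; exact: (mxi xi1 (Slin s)).
  - by move=> s; apply: cf_le1; exact: (mxi xi2 (Slin s)).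
  - exact: (continuous_cf P (mfst xi1)).
  - move=> uni; apply: cf_unimodular_morphism => // s.
    by have := uni s; rewrite complex_mul_conj => -[].
split.
- exact: (@gaussian_distribution (mfun_of (mfst xi1)) s1 b1 h1 g1).
- exact: (@gaussian_distribution (mfun_of (mfst xi2)) s2 b2 h2 g2).
Qed.

End NonSpecialSlope.

Let measure_ae0 (A : set Omega) : measurable A -> {ae P, forall w, ~ A w} -> P A = 0%E.
Proof.
move=> mA h; apply: measure_negligible => //.
by apply: negligibleS h => w Aw; rewrite /= => /(_ Aw).
Qed.

Let mpre d' (T : measurableType d') (f : Omega -> T) A :
  measurable_fun setT f -> measurable A -> measurable (f @^-1` A).
Proof. by move=> mf mA; rewrite -[_ @^-1` _]setTI; exact: mf. Qed.

Let K := [set g : G | g + aG g = 0].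

Let kernel_diff g0 (g : G) : (g + aG g = g0 + aG g0) -> K (g - g0).
Proof.
have aG0 : aG 0 = 0 by apply: (addrI (aG 0)); rewrite -aG_add !addr0.
have aGN x : aG (- x) = - aG x.
  by apply: (addrI (aG x)); rewrite -aG_add !subrr.
by move=> h; rewrite /K /= aG_add aGN addrACA h -opprD subrr.
Qed.

Theorem heyde_X_special : a = -1 ->
  exists (omega : probability (XT R G) R) (x1 x2 : XT R G),
    [/\ omega (~` [set x : XT R G | K x.2]) = 0%E,
        forall A, measurable A ->
          distribution P xi1 A = convX omega (\d_x1) A &
        forall A, measurable A ->
          distribution P xi2 A = convX omega (\d_x2) A].
Proof.
move=> aE.
have [g1 g1_gt0] := exists_atom P (mfun_of (msnd xi1)).
have [g2 g2_gt0] := exists_atom P (mfun_of (msnd xi2)).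
have ae1 := ae_kernel_coset (fun th hth => (modulus_eq1 hth).1) g1_gt0.
have ae2 := ae_kernel_coset (fun th hth => (modulus_eq1 hth).2) g2_gt0.
set kappa := g2 + aG g2 in ae2.
pose zeta w : XT R G := addX (xi1 w) (0, - g1).
have mzeta : measurable_fun setT zeta.
  exact: (measurableT_comp (measurable_addXr (0, - g1)) (measurable_funP xi1)).
(* Translating xi_1 by an atom g1 of its G-component moves the coset onto the kernel. The second
   shift comes from [law_shift], which at a = -1 says that xi_2 and xi_1 + (0, kappa) have the same
   law. *)
exists (distribution P (mfun_of mzeta)), (0, g1), (0, g1 + kappa); split.
- apply: measure_ae0.
    apply: (mpre (A := ~` [set x : XT R G | K x.2]) mzeta).
    apply: measurableC; rewrite -[X in measurable X]setTI.
    exact: (@measurable_snd _ _ R (discr G) measurableT (K : set (discr G)) I).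
  by apply: filterS ae1 => w hw /=; apply; exact: kernel_diff.
- move=> A mA; rewrite (convX_dirac _ (m := distribution P (mfun_of mzeta)) _ mA) //.
  congr (P _); apply/seteqP; split => w; rewrite /zeta /addX /= !addr0 subrK.
    by case: (xi1 w).
  by case: (xi1 w).
- move=> A mA; rewrite (convX_dirac _ (m := distribution P (mfun_of mzeta)) _ mA) //.
  have := law_shift ae2 mA; rewrite aE.
  rewrite (_ : [set w | _] = xi2 @^-1` A); last first.
    apply/seteqP; split => w; rewrite /= (_ : (1 - -1) / 2 * _ = (xi2 w).1) //;
      try by field.
      by case: (xi2 w).
    by case: (xi2 w).
  rewrite /distribution /pushforward => ->; congr (P _); apply: funext => w.
  apply: (congr1 A (x := (_, _)) (y := addX (zeta w) (0, g1 + kappa))).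
  rewrite /zeta /addX /= !addr0 subrr mul0r mul0r addr0; congr pair.
  by rewrite [RHS]addrA subrK.
Qed.

Theorem heyde_X_generic : a != -1 ->
  exists (gam1 gam2 : probability R R) (omega : probability (XT R G) R)
         (x1 x2 : XT R G),
    [/\ gaussian gam1, gaussian gam2,
        omega (~` [set x : XT R G | x.1 = 0 /\ K x.2]) = 0%E,
        forall A, measurable A ->
          distribution P xi1 A = convX (convX (embR gam1) omega) (\d_x1) A &
        forall A, measurable A ->
          distribution P xi2 A = convX (convX (embR gam2) omega) (\d_x2) A].
Proof.
move=> aN1.
have [g1 g1_gt0] := exists_atom P (mfun_of (msnd xi1)).
have [g2 g2_gt0] := exists_atom P (mfun_of (msnd xi2)).
have ae1 := ae_kernel_coset (fun th hth => (modulus_eq1 hth).1) g1_gt0.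
have ae2 := ae_kernel_coset (fun th hth => (modulus_eq1 hth).2) g2_gt0.
set kappa := g2 + aG g2 in ae2.
have [gauss1 gauss2] := gaussian_marginals aN1.
have fac th s hth := cf_factorization aN1 ae2 s (theta := th) hth.
pose eta w : discr G := (xi1 w).2 - g1.
have meta : measurable_fun setT eta.
  exact: (measurable_discr_comp (fun g => g - g1 : discr G) (msnd xi1)).
have meta0 : measurable_fun setT (fun w => (0, eta w) : XT R G).
  exact: measurable_fun_pair.
(* The means stay inside the Gaussian laws, so the shifts have zero real part. The common [omega] is
   the law of the G-component of xi_1, recentred at the atom g1. *)
exists (distribution P (mfun_of (mfst xi1))), (distribution P (mfun_of (mfst xi2))),
  (distribution P (mfun_of meta0)), (0, g1), (0, g1 + kappa); split=> //.
- apply: measure_ae0.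
    apply: (mpre (A := ~` [set x : XT R G | x.1 = 0 /\ K x.2]) meta0).
    apply: measurableC.
    rewrite (_ : [set x | _] = [set 0] `*` (K : set (discr G))) //.
    by apply: measurableX => //; exact: measurable_set1.
  by apply: filterS ae1 => w hw /=; apply; split=> //; exact: kernel_diff.
- move=> A mA.
  apply: (law_eq_convX (Y := mfun_of (msnd xi1)) (lam := distribution P (mfun_of meta))) => //.
  + by move=> w; rewrite /=; case: (xi1 w).
  + apply: independent_components => th s hth; exact: (fac th s hth).1.
  + move=> B; congr (P _).
    by apply/seteqP; split => w; rewrite /eta /= subrK.
- move=> A mA.
  apply: (law_eq_convX (Y := mfun_of (msnd xi2)) (lam := distribution P (mfun_of meta))) => //.
  + by move=> w; rewrite /=; case: (xi2 w).
  + apply: independent_components => th s hth; exact: (fac th s hth).2.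
  + move=> B.
    have mB : (@measurable _ (discr G)) B by [].
    (* For general a only the G-components match, so the shift is applied to the cylinder R x B. *)
    have := law_shift ae2 (measurableX measurableT mB).
    rewrite (_ : [set w | _] = mfun_of (msnd xi2) @^-1` B); last first.
      by apply/seteqP; split => w /=; [case|].
    move=> ->; congr (P _).
    apply: funext => w.
    rewrite /preimage /eta /= [_ - g1 + _]addrA subrK.
    by apply/propext; split=> [[]|].
Qed.

End HeydeOnX.

Local Close Scope complex_scope.
Unset Implicit Arguments.

Theorem theorem3p1 (R : realType) (G : finZmodType)
  (hG : forall g : G, g + g = 0 -> g = 0)
  (a : R) (aG : G -> G)
  (ha : a != 0)
  (aG_add : forall g h : G, aG (g + h) = aG g + aG h)
  (aG_bij : bijective aG)
  (d : measure_display) (Omega : measurableType d) (P : probability Omega R)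
  (xi1 xi2 : {mfun Omega >-> XT R G})
  (hind : forall A B : set (XT R G), measurable A -> measurable B ->
     P (xi1 @^-1` A `&` xi2 @^-1` B) = (P (xi1 @^-1` A) * P (xi2 @^-1` B))%E)
  (hnz1 : forall (s : R) (theta : G -> R), is_character_arg theta ->
     charfun_re (distribution P xi1) s theta <> 0%E \/
     charfun_im (distribution P xi1) s theta <> 0%E)
  (hnz2 : forall (s : R) (theta : G -> R), is_character_arg theta ->
     charfun_re (distribution P xi2) s theta <> 0%E \/
     charfun_im (distribution P xi2) s theta <> 0%E)
  (hsym : let alpha := fun x : XT R G => ((a * x.1)%R, aG x.2) : XT R G in
     let L1 := fun w => addX (xi1 w) (xi2 w) in
     let L2 := fun w => addX (xi1 w) (alpha (xi2 w)) in
     forall C : set (XT R G * XT R G), measurable C ->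
       P ((fun w => (L1 w, L2 w)) @^-1` C) =
       P ((fun w => (L1 w, oppX (L2 w))) @^-1` C)) :
  let K := [set g : G | g + aG g = 0] in
  (a != -1 ->
    exists (gam1 gam2 : probability R R) (omega : probability (XT R G) R)
           (x1 x2 : XT R G),
      [/\ gaussian gam1, gaussian gam2,
          omega (~` [set x : XT R G | x.1 = 0 /\ K x.2]) = 0%E,
          forall A, measurable A ->
            distribution P xi1 A = convX (convX (embR gam1) omega) (\d_x1) A &
          forall A, measurable A ->
            distribution P xi2 A = convX (convX (embR gam2) omega) (\d_x2) A]) /\
  (a = -1 ->
    exists (omega : probability (XT R G) R) (x1 x2 : XT R G),
      [/\ omega (~` [set x : XT R G | K x.2]) = 0%E,
          forall A, measurable A ->
            distribution P xi1 A = convX omega (\d_x1) A &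
          forall A, measurable A ->
            distribution P xi2 A = convX omega (\d_x2) A]).
Proof.
move=> K; split; last exact: heyde_X_special.
exact: heyde_X_generic.
Qed.
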